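(* Let $m\ge2$. For every $\sigma\in\mathcal S_m$ there exists $n_0$ such that $$\alpha_n(12\dots(m-2)\,m\,(m-1))\le\alpha_n(\sigma)\quad\text{for all } n\ge n_0.$$
   Context: $\mathcal S_n$ is the set of permutations of $\{1,\dots,n\}$ written in one-line notation. For a sequence $\tau=\tau_1\dots\tau_k$ of distinct positive integers, $\operatorname{st}(\tau)\in\mathcal S_k$ is obtained by replacing the smallest entry of $\tau$ by $1$, the second smallest by $2$, and so on. For $\sigma\in\mathcal S_m$ and $\pi\in\mathcal S_n$, an occurrence of $\sigma$ in $\pi$ as a consecutive pattern is a block of adjacent entries with $\operatorname{st}(\pi_i\pi_{i+1}\cdots\pi_{i+m-1})=\sigma$. The permutation $\pi$ avoids $\sigma$ if it has no such occurrence, and $\alpha_n(\sigma)$ is the number of permutations in $\mathcal S_n$ that avoid $\sigma$ as a consecutive pattern. Here $12\dots(m-2)\,m\,(m-1)$ is the identity permutation of length $m$ with its last two entries swapped. *)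

(* Defs.v *)
From mathcomp Require Import all_boot all_fingroup.

Set Implicit Arguments.
Unset Strict Implicit.
Unset Printing Implicit Defensive.

(* 'S_n acts on 'I_n = {0, ..., n-1}; positions and entries of the one-line
   notation are shifted to {1, ..., n}. *)
Definition oneline (n : nat) (p : 'S_n) : seq nat :=
  [seq (nat_of_ord (p i)).+1 | i <- enum 'I_n].

(* Only meaningful when the entries of tau are distinct: the rank of x is then
   the number of entries of tau that are at most x. *)
Definition st (tau : seq nat) : seq nat :=
  [seq count (fun y => y <= x) tau | x <- tau].

(* The block starts at the 0-based position i. *)
Definition occurs_at (m n : nat) (sigma : 'S_m) (p : 'S_n) (i : nat) : bool :=
  (i + m <= n) && (st (take m (drop i (oneline p))) == oneline sigma).

Definition avoids (m n : nat) (p : 'S_n) (sigma : 'S_m) : bool :=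
  ~~ [exists i : 'I_n.+1, occurs_at sigma p i].

Definition alpha (n m : nat) (sigma : 'S_m) : nat :=
  #|[set p : 'S_n | avoids p sigma]|.

Fact penult_subproof (m : nat) : 2 <= m -> m - 2 < m.
Proof. by case: m => [|[|m]] // _; rewrite subSS subSS subn0 ltnS leqnSn. Qed.

Fact last_subproof (m : nat) : 2 <= m -> m - 1 < m.
Proof. by case: m => [|m] // _; rewrite subSS subn0. Qed.

Definition swap_last_two (m : nat) (hm : 2 <= m) : 'S_m :=
  tperm (Ordinal (penult_subproof hm)) (Ordinal (last_subproof hm)).

Lemma oneline_swap_last_two (m : nat) (hm : 2 <= m) :
  oneline (swap_last_two hm) = iota 1 (m - 2) ++ [:: m; m - 1].
Proof.
case: m hm => [|[|k]] // hm.
have -> : k.+2 - 2 = k by rewrite !subSS subn0.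
have -> : k.+2 - 1 = k.+1 by rewrite subSS subn0.
have sz (p : 'S_k.+2) : size (oneline p) = k.+2.
  by rewrite size_map size_enum_ord.
apply: (@eq_from_nth _ 0) => [|i].
  by rewrite sz size_cat size_iota addn2.
rewrite sz => ik; rewrite (nth_map ord0) ?size_enum_ord //.
rewrite nth_cat size_iota.
rewrite /swap_last_two permE /= -!(inj_eq val_inj) /= !(fun_if (@nat_of_ord _)) /=.
rewrite !nth_enum_ord // !subSS !subn0 ![i == _]eq_sym.
have [ltik|leki] := ltnP i k.
  by rewrite gtn_eqF // gtn_eqF 1?ltnS 1?ltnW // nth_iota.
have [eki|neki] := eqVneq k i; first by rewrite -eki subnn.
have -> : i = k.+1 by apply/eqP; rewrite eqn_leq -ltnS ik ltn_neqAle neki.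
by rewrite eqxx subSnn.
Qed.

(* Main.v *)
Require Import Defs.
From mathcomp Require Import all_boot all_fingroup.
From mathcomp Require Import all_order all_algebra zify ring lra.

(** Let p(n) = alpha_n(sigma) / n! be the probability that a random permutation
    avoids sigma, and p*(n) the same for the pattern 12...(m-2)m(m-1).  Relative
    orders on disjoint blocks of positions are independent, so inclusion-exclusion
    on the occurrence that ends at the last position gives, for
    q = m / (2m-1)!,
      p*(n) <= p*(n-1) - p*(n-m) / m! + q p*(n-2m+1),
    because the pattern overlaps itself only in one entry and q is the probability
    of two such occurrences.  For sigma one has the reverse inequality
      p(n) >= p(n-1) - p(n-m) / m! + q p(n-2m+1)
    as soon as, for some shift j, two occurrences of sigma at distance j are
    probable enough to outweigh the loss from a third occurrence.  When sigma
    overlaps itself in several entries, the smallest such shift j works; when it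
    does not, j = m-1 works by counting the linear extensions of two crossing
    chains, unless the first and last entries of sigma are, up to reversal and
    complement, those of 12...(m-2)m(m-1), and then both patterns are equally
    avoided.  Since
    p(n-1) <= Z p(n) for a Z slightly above 1, the difference p - p* satisfies a
    recurrence that preserves nonnegativity; hence the inequality holds for every n. *)

Set Implicit Arguments.
Unset Strict Implicit.
Unset Printing Implicit Defensive.

Import Order.TTheory GRing.Theory Num.Theory.

(** * Relative orders and their independence *)

(* One-line notation as a word with 0-based positions and entries; junk value 0
   outside the positions. *)
Definition wd n (p : 'S_n) (i : nat) : nat :=
  if insub i is Some j then (p j : nat) else 0.

Lemma wdE n (p : 'S_n) (i : 'I_n) : wd p i = p i.
Proof. by rewrite /wd valK. Qed.

Lemma wd_lt n (p : 'S_n) i : i < n -> wd p i < n.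
Proof. by move=> lin; rewrite -[i]/(val (Ordinal lin)) wdE. Qed.

Lemma wd_inj n (p : 'S_n) i j : i < n -> j < n -> wd p i = wd p j -> i = j.
Proof.
move=> lin ljn; rewrite -[i]/(val (Ordinal lin)) -[j]/(val (Ordinal ljn)) !wdE.
by move=> /val_inj/perm_inj ->.
Qed.

Definition same_order k (x y : nat -> nat) :=
  forall i j, i < k -> j < k -> (x i < x j) = (y i < y j).

(** Such an event makes sense in every length at least k, and its probability is the same in all of
    them. *)
Definition local k (P : pred (nat -> nat)) :=
  forall x y, same_order k x y -> P x = P y.

Lemma perm_rank n (p : 'S_n) (i : 'I_n) : #|[set j | p j < p i]| = p i.
Proof.
rewrite -(card_imset _ (@perm_inj _ p)).
rewrite (_ : p @: _ = [set j : 'I_n | j < p i]); last first.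
  apply/setP=> j; rewrite inE; apply/imsetP/idP => [[k] | lj].
    by rewrite inE => lk ->.
  by exists (p^-1%g j); rewrite ?inE permKV.
rewrite -sum1_card (eq_bigl (fun j : 'I_n => j < p i)); last by move=> j; rewrite inE.
by rewrite -(big_ord_widen n (fun _ => 1)) ?sum1_card ?card_ord // ltnW.
Qed.

Lemma same_order_perm n (p q : 'S_n) : same_order n (wd p) (wd q) -> p = q.
Proof.
move=> spq; apply/permP=> i; apply: val_inj => /=.
rewrite -(perm_rank p) -(perm_rank q); apply: eq_card => j; rewrite !inE.
by have := spq j i (ltn_ord _) (ltn_ord _); rewrite !wdE.
Qed.

(** The permutation sends each position to the rank of its value among the first k. *)
Lemma standardize k (x : nat -> nat) :
    (forall i j, i < k -> j < k -> x i = x j -> i = j) ->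
  exists p : 'S_k, same_order k (wd p) x.
Proof.
move=> xinj.
pose r (i : 'I_k) := #|[set j : 'I_k | x j < x i]|.
have rmono (i j : 'I_k) : x i < x j -> r i < r j.
  move=> lij; apply: proper_card; apply/properP; split.
    by apply/subsetP=> l; rewrite !inE => /ltn_trans; apply.
  by exists i; rewrite inE // ltnn.
have rk i : r i < k.
  rewrite -[X in _ < X]card_ord -cardsT; apply: proper_card.
  by apply/properP; split; [exact: subsetT | exists i; rewrite ?inE ?ltnn].
have rE (i j : 'I_k) : (r i < r j) = (x i < x j).
  case: (ltngtP (x i) (x j)) => [/rmono//|/rmono|e].
    by move=> h; rewrite ltnNge ltnW.
  by rewrite (val_inj (xinj i j (ltn_ord _) (ltn_ord _) e)) ltnn.
have rinj : injective (fun i => Ordinal (rk i)).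
  move=> i j /(congr1 val) /= e; apply: val_inj; apply: (xinj i j (ltn_ord i) (ltn_ord j)).
  by case: (ltngtP (x i) (x j)) => // /rmono; rewrite e ltnn.
exists (perm rinj) => i j li lj.
by rewrite -[i]/(val (Ordinal li)) -[j]/(val (Ordinal lj)) !wdE !permE /= rE.
Qed.

Definition ordlike k (y x : nat -> nat) :=
  [forall a : 'I_k, forall b : 'I_k, (x a < x b) == (y a < y b)].

Lemma ordlikeP k y x : reflect (same_order k x y) (ordlike k y x).
Proof.
apply: (iffP idP) => [/forallP h a b ak bk|h].
  exact: (eqP (forallP (h (Ordinal ak)) (Ordinal bk))).
by apply/forallP=> a; apply/forallP=> b; apply/eqP; apply: h.
Qed.

Lemma local_ordlike k y : local k (ordlike k y).
Proof.
move=> x x' s; rewrite /ordlike; apply: eq_forallb => a; apply: eq_forallb => b.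
by rewrite s.
Qed.

Definition shift d (x : nat -> nat) i := x (d + i).

Lemma wdM n (a p : 'S_n) i : i < n -> wd (a * p)%g i = wd p (wd a i).
Proof. by move=> lin; rewrite -[i]/(val (Ordinal lin)) !wdE permM. Qed.

Section Blocks.
Variables k l : nat.

Definition block_fun (a : 'S_k) (b : 'S_l) (i : 'I_(k + l)) : 'I_(k + l) :=
  match split i with inl j => lshift l (a j) | inr j => rshift k (b j) end.

Lemma block_inj a b : injective (block_fun a b).
Proof.
apply: (can_inj (g := block_fun a^-1%g b^-1%g)) => i.
rewrite /block_fun; case: (splitP i) => j e.
  by rewrite (unsplitK (inl (a j))) permK; apply: val_inj.
by rewrite (unsplitK (inr (b j))) permK; apply: val_inj.
Qed.

Definition block a b : 'S_(k + l) := perm (@block_inj a b).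

Lemma wd_block_l a b i : i < k -> wd (block a b) i = wd a i.
Proof.
move=> lik; rewrite -[in RHS](_ : val (Ordinal lik) = i) // wdE.
rewrite -[in LHS](_ : val (lshift l (Ordinal lik)) = i) // wdE permE.
by rewrite /block_fun (unsplitK (inl (Ordinal lik))).
Qed.

Lemma wd_block_r a b i : i < l -> wd (block a b) (k + i) = k + wd b i.
Proof.
move=> lil; rewrite -[in RHS](_ : val (Ordinal lil) = i) // wdE.
rewrite -[in LHS](_ : val (rshift k (Ordinal lil)) = k + i) // wdE permE.
by rewrite /block_fun (unsplitK (inr (Ordinal lil))).
Qed.

End Blocks.

Definition cnt n (P : pred (nat -> nat)) := #|[set p : 'S_n | P (wd p)]|.

(** Here [y] may repeat a value among its first k, and then no permutation has its relative order;
    hence only an upper bound. *)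
Lemma cnt_ordlike_le k y : cnt k (ordlike k y) <= 1.
Proof.
apply/card_le1_eqP => p q; rewrite !inE => /ordlikeP sp /ordlikeP sq.
by apply: same_order_perm => i j ik jk; rewrite sp ?sq.
Qed.

Lemma cnt_ordlike k (q : 'S_k) : cnt k (ordlike k (wd q)) = 1.
Proof.
apply/eqP; rewrite eqn_leq cnt_ordlike_le card_gt0.
by apply/set0Pn; exists q; rewrite inE; apply/ordlikeP.
Qed.

(* S_k x S_l acts on the positions of a permutation; along an orbit, the
   relative orders of the two blocks run over all pairs exactly once. *)
Lemma cnt_indep k l (A B : pred (nat -> nat)) : local k A -> local l B ->
  cnt (k + l) (fun x => A x && B (shift k x)) * (k`! * l`!)
  = (k + l)`! * (cnt k A * cnt l B).
Proof.
move=> lA lB.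
pose E (p : 'S_(k + l)) := A (wd p) && B (shift k (wd p)).
have cE n (P : pred (nat -> nat)) : cnt n P = \sum_(p : 'S_n) P (wd p).
  by rewrite /cnt -sum1_card [in LHS]big_mkcond; apply: eq_bigr => p _; rewrite inE; case: (P _).
have e1 : \sum_(p : 'S_(k + l)) \sum_(a : 'S_k) \sum_(b : 'S_l) E (block a b * p)%g
    = cnt (k + l) (fun x => A x && B (shift k x)) * (k`! * l`!).
  rewrite exchange_big /=.
  under eq_bigr => a _ do rewrite exchange_big /=.
  transitivity (\sum_(a : 'S_k) \sum_(b : 'S_l)
                  cnt (k + l) (fun x => A x && B (shift k x))).
    apply: eq_bigr => a _; apply: eq_bigr => b _; rewrite cE.
    by rewrite [RHS](reindex_inj (mulgI (block a b))).
  by rewrite !sum_nat_const !card_Sn mulnA mulnC.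
have e2 p : \sum_(a : 'S_k) \sum_(b : 'S_l) E (block a b * p)%g = cnt k A * cnt l B.
  have pinj i j : i < k + l -> j < k + l -> wd p i = wd p j -> i = j by apply: wd_inj.
  have [a0 sa] : exists q : 'S_k, same_order k (wd q) (wd p).
    by apply: standardize => i j li lj; apply: pinj; rewrite ltn_addr.
  have [b0 sb] : exists q : 'S_l, same_order l (wd q) (shift k (wd p)).
    apply: standardize => i j li lj /pinj; rewrite !ltn_add2l => /(_ li lj).
    by move/addnI.
  transitivity (\sum_(a : 'S_k) \sum_(b : 'S_l) A (wd (a * a0)%g) * B (wd (b * b0)%g)).
    apply: eq_bigr => a _; apply: eq_bigr => b _; rewrite /E mulnb; congr (nat_of_bool (_ && _)).
      apply: lA => i j li lj; rewrite !wdM ?ltn_addr // !wd_block_l //.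
      by rewrite -sa ?wd_lt.
    apply: lB => i j li lj; rewrite /shift !wdM ?ltn_add2l // !wd_block_r //.
    by rewrite sb ?wd_lt.
  transitivity ((\sum_(a : 'S_k) A (wd (a * a0)%g)) * \sum_(b : 'S_l) B (wd (b * b0)%g)).
    by rewrite big_distrl; apply: eq_bigr => a _; rewrite big_distrr.
  rewrite !cE; congr (_ * _).
    by rewrite [RHS](reindex_inj (mulIg a0)).
  by rewrite [RHS](reindex_inj (mulIg b0)).
by rewrite -e1 (eq_bigr _ (fun p _ => e2 p)) sum_nat_const card_Sn.
Qed.

(** * Probabilities and occurrences *)

Section Probability.
Local Open Scope ring_scope.

Definition pr n (P : pred (nat -> nat)) : rat := (cnt n P)%:R / (n`!)%:R.

Lemma fact_gt0R n : 0 < (n`!)%:R :> rat.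
Proof. by rewrite ltr0n fact_gt0. Qed.

Lemma pr_ge0 n P : 0 <= pr n P.
Proof. by rewrite divr_ge0 ?ler0n. Qed.

Lemma pr_le_cnt n P c : (cnt n P <= c)%N -> pr n P <= c%:R / (n`!)%:R.
Proof. by move=> le; rewrite ler_wpM2r ?invr_ge0 ?ler0n // ler_nat. Qed.

Lemma pr_ge_cnt n P c : (c <= cnt n P)%N -> c%:R / (n`!)%:R <= pr n P.
Proof. by move=> le; rewrite ler_wpM2r ?invr_ge0 ?ler0n // ler_nat. Qed.

Lemma pr_le n (P Q : pred (nat -> nat)) :
  (forall p : 'S_n, P (wd p) -> Q (wd p)) -> pr n P <= pr n Q.
Proof.
move=> PQ; apply: pr_le_cnt; apply: subset_leq_card.
by apply/subsetP => p; rewrite !inE; apply: PQ.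
Qed.

Lemma pr_eq n (P Q : pred (nat -> nat)) :
  (forall p : 'S_n, P (wd p) = Q (wd p)) -> pr n P = pr n Q.
Proof. by move=> PQ; apply/eqP; rewrite eq_le !pr_le // => p; rewrite PQ. Qed.

Lemma pr_eq0 n (P : pred (nat -> nat)) :
  (forall p : 'S_n, ~~ P (wd p)) -> pr n P = 0.
Proof.
move=> P0; rewrite /pr /cnt (_ : [set p | _] = set0) ?cards0 ?mul0r //.
by apply/setP => p; rewrite !inE; apply/negbTE.
Qed.

Lemma pr_true n : pr n xpredT = 1.
Proof.
rewrite /pr /cnt (_ : [set p | _] = setT); last by apply/setP=> p; rewrite !inE.
by rewrite cardsT card_Sn divff // gt_eqF ?fact_gt0R.
Qed.

Lemma pr_split n (Q P : pred (nat -> nat)) :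
  pr n P = pr n (fun x => P x && Q x) + pr n (fun x => P x && ~~ Q x).
Proof.
rewrite /pr -mulrDl -natrD; congr (_%:R / _).
rewrite /cnt -(cardsID [set p : 'S_n | Q (wd p)]); congr (_ + _)%N.
  by apply: eq_card => p; rewrite !inE.
by apply: eq_card => p; rewrite !inE andbC.
Qed.

Lemma pr_union n (P : pred (nat -> nat)) a b (Q : nat -> pred (nat -> nat)) :
    (forall p : 'S_n, P (wd p) -> exists2 s, (a <= s < b)%N & Q s (wd p)) ->
  pr n P <= \sum_(a <= s < b) pr n (Q s).
Proof.
move=> PQ; rewrite /pr -mulr_suml -natr_sum; apply: pr_le_cnt.
rewrite /cnt -sum1_card big_mkcond /=.
have -> : (\sum_(a <= s < b) #|[set p : 'S_n | Q s (wd p)]|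
    = \sum_(p : 'S_n) \sum_(a <= s < b) Q s (wd p))%N.
  rewrite exchange_big; apply: eq_bigr => s _ /=.
  by rewrite -sum1_card big_mkcond; apply: eq_bigr => p _; rewrite inE; case: (Q _ _).
apply: leq_sum => p _; rewrite inE; case: ifP => // /PQ[s sab Qs].
by rewrite (big_rem s) ?mem_index_iota //= Qs.
Qed.

Lemma pr_indep k l (A B : pred (nat -> nat)) : local k A -> local l B ->
  pr (k + l) (fun x => A x && B (shift k x)) = pr k A * pr l B.
Proof.
move=> lA lB; have := cnt_indep lA lB; rewrite /pr.
move/(congr1 (fun n : nat => n%:R : rat)); rewrite !natrM => e.
have := fact_gt0R k; have := fact_gt0R l; have := fact_gt0R (k + l).
set a := (k`!)%:R in e *; set b := (l`!)%:R in e *; set c := ((k + l)`!)%:R in e *.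
move=> c0 b0 a0; rewrite mulf_div; apply/eqP.
by rewrite eqr_div ?mulf_neq0 ?lt0r_neq0 // e mulrC.
Qed.

Lemma pr_local k n (A : pred (nat -> nat)) : local k A -> (k <= n)%N ->
  pr n A = pr k A.
Proof.
move=> lA /subnKC <-; rewrite -[RHS]mulr1 -(pr_true (n - k)) -pr_indep //.
by apply: pr_eq => p; rewrite andbT.
Qed.

End Probability.

Lemma localI k P Q : local k P -> local k Q -> local k (fun x => P x && Q x).
Proof. by move=> lP lQ x y s; rewrite (lP x y s) (lQ x y s). Qed.

Section Occurrences.
Variables (m : nat) (sigma : 'S_m).

Definition occ (i : nat) (x : nat -> nat) : bool := ordlike m (wd sigma) (shift i x).

Lemma occP i x : reflect (same_order m (shift i x) (wd sigma)) (occ i x).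
Proof. exact: ordlikeP. Qed.

Lemma occ_shift d i x : occ (d + i) x = occ i (shift d x).
Proof.
rewrite /occ /ordlike /shift; apply: eq_forallb => a; apply: eq_forallb => b.
by rewrite !addnA.
Qed.

Lemma local_occ i k : i + m <= k -> local k (occ i).
Proof.
move=> imk x y s; apply: local_ordlike => a b am bm; rewrite /shift.
by rewrite s // (leq_trans _ imk) // ltn_add2l.
Qed.

(** For n < m the truncated difference is 0, so no start is tested and the event always holds. *)
Definition avoid (n : nat) (x : nat -> nat) : bool :=
  all (fun i => ~~ occ i x) (iota 0 (n.+1 - m)).

Lemma avoidP n x : reflect (forall i, i + m <= n -> ~~ occ i x) (avoid n x).
Proof.
apply: (iffP allP) => h i; last by rewrite mem_iota => ?; apply: h; lia.
by move=> ?; apply: h; rewrite mem_iota; lia.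
Qed.

Lemma local_avoid n k : n <= k -> local k (avoid n).
Proof.
move=> nk x y s; apply/avoidP/avoidP => h i imn.
  by rewrite -(local_occ (leq_trans imn nk) s) h.
by rewrite (local_occ (leq_trans imn nk) s) h.
Qed.

Lemma avoidW k n x : k <= n -> avoid n x -> avoid k x.
Proof. by move=> kn /avoidP h; apply/avoidP => i ik; apply: h; apply: leq_trans kn. Qed.

Lemma onelineE n (p : 'S_n) : oneline p = [seq (wd p i).+1 | i <- iota 0 n].
Proof.
rewrite /oneline -val_enum_ord -map_comp; apply: eq_map => i /=.
by rewrite wdE.
Qed.

(** In [st] each entry is its rank within the block, and the entries of [sigma] are ranks too; equal
    ranks amount to equal comparisons. *)
Lemma occurs_atE n (p : 'S_n) i :
  occurs_at sigma p i = (i + m <= n) && occ i (wd p).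
Proof.
rewrite /occurs_at; case: leqP => //= imn.
rewrite !onelineE -map_drop -map_take drop_iota take_iota add0n.
rewrite (_ : minn m (n - i) = m); last by lia.
rewrite /st -map_comp.
have -> : iota i m = [seq i + a | a <- iota 0 m] by rewrite -iotaDl addn0.
rewrite -map_comp.
set w := [seq (wd p j).+1 | j <- _].
have cw a : count (fun y => y <= (wd p (i + a)).+1) w
    = \sum_(b < m) (wd p (i + b) <= wd p (i + a)).
  rewrite -(big_mkord xpredT (fun b => nat_of_bool (wd p (i + b) <= wd p (i + a)))).
  rewrite /w count_map -sum1_count big_mkcond.
  by rewrite /index_iota subn0 big_map; apply: eq_bigr => b _ /=; rewrite ltnS; case: leqP.
have cs a : a < m -> \sum_(b < m) (wd sigma b <= wd sigma a) = (wd sigma a).+1.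
  move=> am; have [b ->] : exists b : 'I_m, a = b by exists (Ordinal am).
  rewrite wdE -[in RHS]perm_rank -sum1_card (bigD1 b) //= !wdE leqnn add1n; congr _.+1.
  rewrite big_mkcond [RHS]big_mkcond; apply: eq_bigr => c _ /=; rewrite inE wdE ltn_neqAle.
  rewrite -(inj_eq (@perm_inj _ sigma)) -val_eqE /=.
  by case: eqP => //= _; case: leqP.
have winj a b : a < m -> b < m -> wd p (i + a) = wd p (i + b) -> a = b.
  by move=> am bm /wd_inj e; apply/(@addnI i)/e; lia.
apply/eqP/occP => [/eq_in_map e | so].
  have {}e a : a < m -> \sum_(b < m) (wd p (i + b) <= wd p (i + a)) = (wd sigma a).+1.
    by move=> am; rewrite -cw -(e a) // mem_iota.
  have mono a b : a < m -> b < m -> wd p (i + a) < wd p (i + b) -> wd sigma a < wd sigma b.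
    move=> am bm lab; rewrite -ltnS -!e // (bigD1 (Ordinal bm)) //
      [X in _ < X](bigD1 (Ordinal bm)) //=.
    rewrite leqnn (leqNgt (wd p _)) lab /= add0n add1n ltnS; apply: leq_sum => c _.
    by case: (leqP _ (wd p (i + a))) => // h; rewrite (leq_trans h) // ltnW.
  move=> a b am bm; rewrite /shift; apply/idP/idP; first exact: mono.
  move=> l; case: ltngtP => // [/(mono _ _ bm am)|/(winj _ _ am bm)] h; move: l.
    by rewrite ltnNge ltnW.
  by rewrite h ltnn.
apply/eq_in_map => a; rewrite mem_iota /= => am; rewrite cw -cs //.
by apply: eq_bigr => b _; rewrite [in LHS]leqNgt [in RHS]leqNgt -so.
Qed.

Lemma avoidsE n (p : 'S_n) : avoids p sigma = avoid n (wd p).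
Proof.
rewrite /avoids; apply/idP/avoidP => [/existsPn h i imn | h].
  have lin : i < n.+1 by lia.
  by have := h (Ordinal lin); rewrite occurs_atE imn.
by apply/existsPn => i; rewrite occurs_atE; case: leqP => //= /h.
Qed.

Lemma alphaE n : alpha n sigma = cnt n (avoid n).
Proof. by apply: eq_card => p; rewrite !inE avoidsE. Qed.

End Occurrences.

(** * Recurrences for the avoidance probability *)

(* u (n - d), with the sequence extended by 0 to negative indices. *)
Definition back (u : nat -> rat) n d : rat := if d <= n then u (n - d) else 0%R.

Section Recurrences.
Local Open Scope ring_scope.
Variables (m : nat) (sigma : 'S_m).

Local Notation occ := (occ sigma).
Local Notation avoid := (avoid sigma).

Definition pav n : rat := pr n (avoid n).

(* Occurrences of [sigma] at distance s are compatible. *)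
Definition ov s : bool := ordlike (m - s) (wd sigma) (shift s (wd sigma)).

Definition pcl2 j : rat := pr (m + j) (fun x => occ 0 x && occ j x).

Definition pcl3 s j : rat :=
  pr (s + (m + j)) (fun x => occ 0 x && (occ s x && occ (s + j) x)).

Lemma pr_occ : pr m (occ 0) = 1 / (m`!)%:R.
Proof. by rewrite /pr (_ : cnt m _ = 1%N) //; apply: cnt_ordlike. Qed.

Lemma pr_avoid_shift k l (C : pred (nat -> nat)) : local l C ->
  pr (k + l) (fun x => avoid k x && C (shift k x)) = pav k * pr l C.
Proof. by move=> lC; apply: pr_indep; first exact: local_avoid. Qed.

Lemma pav_ge0 n : 0 <= pav n. Proof. exact: pr_ge0. Qed.

Lemma pav_small n : (n < m)%N -> pav n = 1.
Proof.
move=> nm; rewrite -(pr_true n); apply: pr_eq => p; apply/avoidP => i; lia.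
Qed.

(** If the first n positions avoid the pattern, one further position can only create an occurrence
    that starts at n + 1 - m. *)
Lemma pavS n : (m <= n.+1)%N ->
  pav n = pav n.+1 + pr n.+1 (fun x => avoid n x && occ (n.+1 - m) x).
Proof.
move=> mn; rewrite /pav -(pr_local (local_avoid sigma (leqnn n)) (leqnSn n)).
rewrite (pr_split _ (occ (n.+1 - m))) addrC; congr (_ + _).
apply: pr_eq => p; apply/andP/idP => [[/avoidP h o]|a].
  apply/avoidP => i imn; have [/h//|lt] := leqP (i + m) n.
  by rewrite (_ : i = n.+1 - m)%N //; lia.
split; first by apply: avoidW a.
by move/avoidP: a; apply; lia.
Qed.

Lemma pavS_le n : pav n.+1 <= pav n.
Proof.
have [nm|mn] := ltnP n.+1 m; first by rewrite !pav_small // ltnW.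
by rewrite (pavS mn) lerDl pr_ge0.
Qed.

Lemma pr_avoid_occ k : pr (k + m) (fun x => avoid k x && occ k x) = pav k / (m`!)%:R.
Proof.
rewrite -[_^-1]mul1r -pr_occ -pr_avoid_shift; last exact: local_occ.
by apply: pr_eq => p; rewrite -occ_shift addn0.
Qed.

Lemma pr_avoid_cl2 k j : pr (k + (m + j)) (fun x => avoid k x && (occ k x && occ (k + j) x))
  = pav k * pcl2 j.
Proof.
rewrite -pr_avoid_shift; last first.
  by apply: localI; apply: local_occ; lia.
by apply: pr_eq => p; rewrite -!occ_shift addn0.
Qed.

Lemma pr_avoid_cl3 k s j :
  pr (k + (s + (m + j))) (fun x => avoid k x && (occ k x && (occ (k + s) x && occ (k + (s + j)) x)))
  = pav k * pcl3 s j.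
Proof.
rewrite -pr_avoid_shift; last first.
  by apply: localI; [|apply: localI]; apply: local_occ; lia.
by apply: pr_eq => p; rewrite -!occ_shift addn0.
Qed.

Lemma occ_ov i s x : occ i x -> occ (i + s) x -> ov s.
Proof.
move=> /occP oi /occP os; apply/ordlikeP => a b la lb.
rewrite /shift -oi /shift -?os; try lia.
by rewrite /shift !addnA.
Qed.

(** Weakening avoidance on the first n positions to the first n + 1 - m makes it independent of the
    last block. *)
Lemma pav_lower_small n : (0 < m)%N -> (m <= n.+1)%N ->
  pav n - pav (n.+1 - m) / (m`!)%:R <= pav n.+1.
Proof.
move=> m0 mn; rewrite [pav n]pavS // lerBlDr lerD2l -pr_avoid_occ subnK //.
by apply: pr_le => p /andP[a ->]; rewrite (avoidW _ a) //; lia.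
Qed.

(** Refines the previous bound: the last block starts at k + j, and a further occurrence at k
    already lies within the first n positions, so these cases can be subtracted. The sum corrects
    for a third occurrence, s positions before k. *)
Lemma pav_lower k j n : (0 < j < m)%N -> n.+1 = (k + (m + j))%N ->
  pav n - pav (k + j) / (m`!)%:R
    + (pav k * pcl2 j - \sum_(m - j <= s < m) back pav k s * pcl3 s j) <= pav n.+1.
Proof.
move=> /andP[j0 jm] nE.
have lem : pr n.+1 (fun x => avoid n x && occ (n.+1 - m) x)
    + pr n.+1 (fun x => avoid (k + j) x && (occ k x && occ (k + j) x))
    <= pav (k + j) / (m`!)%:R.
  rewrite -pr_avoid_occ (_ : (k + j + m = n.+1)%N); last lia.
  rewrite [leRHS](pr_split _ (occ k)) addrC lerD //.
    by apply: pr_le => p /and3P[-> -> ->].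
  apply: pr_le => p /andP[a]; rewrite (_ : n.+1 - m = k + j)%N; last lia.
  move=> ->; rewrite (avoidW _ a) /=; last lia.
  by move/avoidP: a; apply; lia.
have cl : pav k * pcl2 j <=
    pr n.+1 (fun x => avoid (k + j) x && (occ k x && occ (k + j) x))
    + \sum_(m - j <= s < m) back pav k s * pcl3 s j.
  rewrite -pr_avoid_cl2 -nE (pr_split _ (avoid (k + j))) lerD //.
    by apply: pr_le => p /andP[/andP[_ ->] ->].
  pose Q s x := (s <= k)%N && (avoid (k - s) x && (occ (k - s) x && (occ k x && occ (k + j) x))).
  apply: (@le_trans _ _ (\sum_(m - j <= s < m) pr n.+1 (Q s))).
    apply: pr_union => p /andP[/and3P[/avoidP a ok okj] na].
    (* An occurrence within the first k + j positions starts before k and, since the first k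
       positions avoid the pattern, reaches beyond them; so its distance s to k is between m - j and
       m - 1. *)
    have [i [imk oi]] : exists i, (i + m <= k + j)%N /\ occ i (wd p).
      have [/hasP[i]|/hasPn h] := boolP (has (fun i => occ i (wd p)) (iota 0 (k + j).+1)).
        move=> _ _; move: na; rewrite /avoid -has_predC => /hasP[i'].
        by rewrite mem_iota /= negbK => ii oi; exists i'; split=> //; lia.
      case/negP: na; apply/avoidP => i imn; apply: h; rewrite mem_iota; lia.
    have km : (k < i + m)%N by rewrite ltnNge; apply/negP => /a; rewrite oi.
    exists (k - i)%N; first by lia.
    rewrite /Q leq_subr subKn; last lia.
    rewrite oi ok okj !andbT /=; apply/avoidP => l lm; apply: a; lia.
  apply: ler_sum_nat => s /andP[sj sm]; rewrite /back /Q; case: leqP => [sk|_]; last first.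
    by rewrite mul0r pr_eq0.
  rewrite -pr_avoid_cl3 (_ : (k - s + (s + (m + j)) = n.+1)%N); last lia.
  by apply: pr_le => p; rewrite subnK // addnA subnK.
rewrite [pav n]pavS ?nE; last lia.
move: lem cl; rewrite nE; lra.
Qed.

Lemma pcl3_ov s j : ~~ ov s -> pcl3 s j = 0.
Proof.
move=> no; apply: pr_eq0 => p.
by apply/negP => /and3P[o0 os _]; case/negP: no; apply: (occ_ov (i := 0)) os.
Qed.

(** The first s positions meet neither later occurrence; their relative order, prescribed by the
    first occurrence, is an independent event of probability at most 1/s!. *)
Lemma pcl3_le s j : (s <= m)%N -> pcl3 s j <= pcl2 j / (s`!)%:R.
Proof.
move=> sm; rewrite mulrC; set A := ordlike s (wd sigma).
have A1 : pr s A <= (s`!)%:R^-1.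
  by apply: (le_trans (pr_le_cnt (cnt_ordlike_le _ _))); rewrite mul1r.
apply: (@le_trans _ _ (pr s A * pcl2 j)); last by rewrite ler_wpM2r ?pr_ge0.
rewrite -pr_indep; [|exact: local_ordlike|by apply: localI; apply: local_occ; lia].
apply: pr_le => p /and3P[/occP o0 os osj]; rewrite -!occ_shift addn0 os osj !andbT.
by apply/ordlikeP => a b sa sb; rewrite -o0 ?(leq_trans _ sm).
Qed.

(** The [pcl2] term pays for words with an occurrence at the end that avoid the pattern on the first
    n + 1 - m positions but not on the first n. Their earlier occurrence meets the last block, hence
    in exactly one entry. *)
Lemma pav_upper n : (0 < m)%N -> (forall s, (0 < s < m.-1)%N -> ~~ ov s) -> (m <= n.+1)%N ->
  pav n.+1 <= pav n - pav (n.+1 - m) / (m`!)%:R + back pav n.+1 (m + m.-1) * pcl2 m.-1.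
Proof.
move=> m0 nov mn; rewrite [pav n]pavS //.
suff : pav (n.+1 - m) / (m`!)%:R <= pr n.+1 (fun x => avoid n x && occ (n.+1 - m) x)
    + back pav n.+1 (m + m.-1) * pcl2 m.-1 by lra.
rewrite -pr_avoid_occ subnK // (pr_split _ (avoid n)) lerD //.
  by apply: pr_le => p /andP[/andP[_ ->] ->].
have key (p : 'S_n.+1) : avoid (n.+1 - m) (wd p) -> occ (n.+1 - m) (wd p) -> ~~ avoid n (wd p) ->
    (m + m.-1 <= n.+1)%N /\ occ (n.+1 - (m + m.-1)) (wd p).
  move=> /avoidP a o; rewrite /avoid -has_predC => /hasP[i].
  rewrite mem_iota /= negbK => ii oi.
  have im : (n.+1 - m < i + m)%N by rewrite ltnNge; apply/negP => /a; rewrite oi.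
  have [d dE] : exists d, (n.+1 - m = i + d)%N by exists (n.+1 - m - i)%N; lia.
  move: o; rewrite dE => /(occ_ov oi) ovd.
  have d0 : ~~ (0 < d < m.-1)%N by apply/negP => /nov; rewrite ovd.
  have ? : (d = m.-1)%N by lia.
  by split; [lia | rewrite (_ : n.+1 - (m + m.-1) = i)%N //; lia].
rewrite /back; case: leqP => [le|gt]; last first.
  rewrite mul0r pr_eq0 // => p.
  by apply/negP => /andP[/andP[a o] na]; have [] := key _ a o na; lia.
rewrite -pr_avoid_cl2 subnK //; apply: pr_le => p /andP[/andP[a o] na].
have [_ ->] := key _ a o na; rewrite (avoidW _ a) /=; last lia.
by move: o; rewrite (_ : n.+1 - m = n.+1 - (m + m.-1) + m.-1)%N //; lia.
Qed.

End Recurrences.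

(** * Comparison of recurrences *)

Section Sequences.
Local Open Scope ring_scope.

Lemma back_ge0 u n d : (forall k, 0 <= u k) -> 0 <= back u n d.
Proof. by move=> u0; rewrite /back; case: ifP. Qed.

Lemma ratio_iter (u : nat -> rat) Z n k : 0 <= Z ->
  (forall i, (i < n + k)%N -> u i <= Z * u i.+1) -> u n <= Z ^+ k * u (n + k)%N.
Proof.
move=> Z0; elim: k => [|k IH] h; first by rewrite mul1r addn0.
apply: le_trans (IH _) _ => [i ik|]; first by apply: h; lia.
rewrite exprSr -mulrA ler_wpM2l ?exprn_ge0 // addnS; apply: h; lia.
Qed.

Lemma back_le u Z n d : 0 <= Z -> (forall k, 0 <= u k) ->
  (forall k, u k <= Z * u k.+1) -> back u n d <= Z ^+ d * u n.
Proof.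
move=> Z0 u0 uZ; rewrite /back; case: leqP => [dn|_].
  by rewrite -[X in _ <= _ * u X](subnK dn); apply: ratio_iter.
by rewrite mulr_ge0 ?exprn_ge0.
Qed.

(** Nonnegativity and growth bound go through one induction: the growth bound turns the delayed term
    into at most c Z^(m-1) u(n), and c Z^m <= Z - 1 makes the remaining factor 1 - c Z^(m-1) at
    least 1/Z. *)
Lemma recurrence_ge0 (u : nat -> rat) m d c q Z : (0 < m)%N -> (0 < d)%N -> 1 <= Z -> 0 <= c ->
    0 <= q -> c * Z ^+ m <= Z - 1 -> 0 <= u 0%N ->
    (forall n, u n - c * back u n.+1 m + q * back u n.+1 d <= u n.+1) ->
  forall n, 0 <= u n /\ u n <= Z * u n.+1.
Proof.
move=> m0 d0 Z1 c0 q0 cZ u0 rec.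
have Z0 : 0 <= Z by lra.
suff P n : (forall k, (k <= n)%N -> 0 <= u k) /\ (forall k, (k < n)%N -> u k <= Z * u k.+1).
  by move=> n; have [h1 h2] := P n.+1; split; [apply: h1 | apply: h2].
elim: n => [|n [IH1 IH2]].
  by split=> // k; rewrite leqn0 => /eqP ->.
have bd : 0 <= back u n.+1 d.
  by rewrite /back; case: ifP => // dn; apply: IH1; lia.
have bm : back u n.+1 m <= Z ^+ m.-1 * u n.
  rewrite /back; case: leqP => [mn|_]; last by rewrite mulr_ge0 ?exprn_ge0 ?IH1.
  rewrite (_ : u n = u (n.+1 - m + m.-1)%N); last by congr u; lia.
  by apply: ratio_iter => // i ii; apply: IH2; lia.
have un : 0 <= u n by apply: IH1.
have key : u n * (1 - c * Z ^+ m.-1) <= u n.+1.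
  apply: le_trans (rec n); rewrite mulrBr mulr1.
  have h1 : 0 <= q * back u n.+1 d by rewrite mulr_ge0.
  have h2 : c * back u n.+1 m <= c * (Z ^+ m.-1 * u n) by rewrite ler_wpM2l.
  by lra.
have key2 : u n <= Z * u n.+1.
  apply: (@le_trans _ _ (Z * (u n * (1 - c * Z ^+ m.-1)))); last by rewrite ler_wpM2l.
  rewrite (_ : Z * _ = u n * (Z - c * Z ^+ m)); last first.
    by rewrite -[in RHS](prednK m0) exprS; ring.
  by rewrite ler_peMr //; lra.
have un1 : 0 <= u n.+1.
  have : 0 <= Z * u n.+1 by apply: le_trans key2.
  by rewrite pmulr_rge0 //; lra.
split=> k; first by rewrite leq_eqVlt ltnS => /orP[/eqP->//|/IH1].
by rewrite ltnS leq_eqVlt => /orP[/eqP->//|/IH2].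
Qed.

End Sequences.

Section Comparison.
Local Open Scope ring_scope.
Variables (m : nat) (sigma : 'S_m).
Let p := pav sigma.

Lemma pav_rec_weak n : (0 < m)%N -> p n - 1 / (m`!)%:R * back p n.+1 m <= p n.+1.
Proof.
move=> m0; rewrite /back; case: leqP => [mn|nm].
  by rewrite mulrC mulrA mulr1; apply: pav_lower_small.
by rewrite mulr0 subr0 /p !pav_small // ltnW.
Qed.

(** With n + 1 = k + m + j, the growth bound estimates the other delayed terms of [pav_lower] and
    the q term by powers of Z times [p k]; the numerical hypothesis is what remains after dividing
    by [p k]. *)
Lemma pav_rec_strong Z q j : 1 <= Z -> (forall n, p n <= Z * p n.+1) -> (0 < j < m)%N -> 0 <= q ->
    q * Z ^+ (m.-1 - j) + \sum_(m - j <= s < m) Z ^+ s * pcl3 sigma s j <= pcl2 sigma j ->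
  forall n, p n - 1 / (m`!)%:R * back p n.+1 m + q * back p n.+1 (m + m.-1) <= p n.+1.
Proof.
move=> Z1 ratio jm q0 cond n.
have Z0 : 0 <= Z by lra.
have p0 k : 0 <= p k by apply: pav_ge0.
(* Below length m + j the q term is 0 by the convention of [back], since j <= m - 1. *)
have [lt|le] := ltnP n.+1 (m + j).
  rewrite [X in _ + _ * X](_ : _ = 0); last by rewrite /back; case: leqP => //; lia.
  by rewrite mulr0 addr0; apply: pav_rec_weak; lia.
have [k nE] : exists k, n.+1 = (k + (m + j))%N by exists (n.+1 - (m + j))%N; lia.
apply: (le_trans _ (pav_lower sigma jm nE)); rewrite -/p.
rewrite [back p n.+1 m](_ : _ = p (k + j)%N); last first.
  by rewrite /back nE ifT; [congr p|]; lia.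
rewrite [back p n.+1 _](_ : _ = back p k (m.-1 - j)); last first.
  by rewrite /back nE; do 2 case: leqP => ?; try (by []); try lia; congr p; lia.
rewrite mulrC mulrA mulr1 lerD2l.
have h1 : q * back p k (m.-1 - j) <= q * (Z ^+ (m.-1 - j) * p k).
  by rewrite ler_wpM2l // back_le.
have h2 : \sum_(m - j <= s < m) back p k s * pcl3 sigma s j
    <= p k * \sum_(m - j <= s < m) Z ^+ s * pcl3 sigma s j.
  rewrite mulr_sumr; apply: ler_sum => s _.
  rewrite [leRHS](_ : _ = Z ^+ s * p k * pcl3 sigma s j); last by ring.
  by rewrite ler_wpM2r ?pr_ge0 // back_le.
have := ler_wpM2l (p0 k) cond; rewrite mulrDr.
lra.
Qed.

End Comparison.

Lemma alpha_pav n m (sigma tau : 'S_m) :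
  (alpha n sigma <= alpha n tau) = (pav sigma n <= pav tau n)%R.
Proof. by rewrite !alphaE /pav /pr ler_pM2r ?invr_gt0 ?fact_gt0R // ler_nat. Qed.

Section Growth.
Local Open Scope ring_scope.

Lemma pow_1Dinv m : (0 < m)%N -> (1 + (3 * m%:R)^-1 : rat) ^+ m <= 3%:R / 2%:R.
Proof.
move=> m0; set x := (_^-1 : rat).
have mx : m%:R * x = 3%:R^-1.
  by rewrite /x invfM mulrCA divff ?mulr1 // pnatr_eq0 -lt0n.
have x0 : 0 < x by rewrite invr_gt0 mulr_gt0 // ltr0n.
(* A Bernoulli-type inequality; at k = m the second factor is 2/3. *)
have B k : (k <= m)%N -> (1 + x) ^+ k * (1 - k%:R * x) <= 1.
  elim: k => [|k IH] km; first by rewrite mul0r subr0 mulr1.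
  apply: le_trans (IH (ltnW km)); rewrite exprSr -mulrA ler_wpM2l ?exprn_ge0 //; first lra.
  rewrite -natr1; have : 0 <= k%:R * x by rewrite mulr_ge0 ?ler0n //; lra.
  have : 0 <= x * x by rewrite mulr_ge0; lra.
  have : 0 <= k%:R * x * x by rewrite !mulr_ge0 ?ler0n; lra.
  move=> *; rewrite (_ : _ * _ = 1 - k%:R * x - (x * x) - k%:R * x * x); last by ring.
  lra.
have := B m (leqnn m); rewrite mx.
set y := (_ ^+ _); lra.
Qed.

End Growth.

(** * Clusters of two occurrences *)

Lemma same_order_mono k (x y : nat -> nat) :
    (forall a b, a < k -> b < k -> y a = y b -> a = b) ->
    (forall a b, a < k -> b < k -> y a < y b -> x a < x b) ->
  same_order k x y.
Proof.
move=> inj mono a b ak bk; apply/idP/idP; last exact: mono.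
case: (ltngtP (y a) (y b)) => // [/(mono _ _ bk ak)|/(inj _ _ ak bk)->].
  by move=> h /(ltn_trans h); rewrite ltnn.
by rewrite ltnn.
Qed.

Section Amalgam.
Variables (m : nat) (sigma : 'S_m).
Let s := wd sigma.

Lemma cluster_word_cnt N (P : pred (nat -> nat)) (x : nat -> nat) : local N P ->
  (forall i j, i < N -> j < N -> x i = x j -> i = j) -> P x -> 0 < cnt N P.
Proof.
move=> lP /standardize[p sp] Px; rewrite card_gt0; apply/set0Pn; exists p.
by rewrite inE (lP _ _ sp).
Qed.

(* Two copies of [sigma] that agree on their common positions are amalgamated
   by placing every new element of the second copy just above the largest
   common element that lies below it. *)
Lemma pcl2_ov_ge j : 0 < j < m -> ov sigma j -> (1 / ((m + j)`!)%:R <= pcl2 sigma j)%R.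
Proof.
move=> /andP[j0 jm] /ordlikeP ovj; apply: (pr_ge_cnt (c := 1)).
have s_lt i : i < m -> s i < m by apply: wd_lt.
have s_inj a b : a < m -> b < m -> s a = s b -> a = b by apply: wd_inj.
(* [f t] is one more than the largest first-copy value at a common position whose second-copy value
   is below t, and 0 if there is none. *)
pose f t := \max_(c < m | (j <= c) && (s (c - j) < t)) (s c).+1.
have f_mono t t' : t <= t' -> f t <= f t'.
  move=> tt'; apply/bigmax_leqP => c /andP[jc lc].
  by apply: (@leq_bigmax_cond _ _ (fun c : 'I_m => (s c).+1)); rewrite jc (leq_trans lc).
(* First-copy values become positive multiples of m + 2; the new entries fall into the gaps, with
   residues between 1 and m. *)
pose x i := if i < m then (s i).+1 * m.+2 else f (s (i - j)) * m.+2 + (s (i - j)).+1.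
have o0 : occ sigma 0 x.
  by apply/occP => a b am bm; rewrite /shift /x am bm ltn_mul2r.
have oj : occ sigma j x.
  apply/occP; apply: same_order_mono => // a b am bm lab.
  rewrite -/s in lab; have sam := s_lt _ am; have sbm := s_lt _ bm.
  rewrite /shift /x !addKn; case: (ltnP (j + a) m) => ja; case: (ltnP (j + b) m) => jb.
  - rewrite ltn_mul2r /= ltnS; have := ovj a b; rewrite /shift => -> //; lia.
  - have h : (s (j + a)).+1 <= f (s b).
      apply: (@leq_bigmax_cond _ _ (fun c : 'I_m => (s c).+1) (Ordinal ja)).
      by rewrite /= leq_addr addKn.
    by rewrite addnS ltnS; apply: leq_trans (leq_addr _ _); rewrite leq_mul2r h orbT.
  - have h : f (s a) <= s (j + b).
      apply/bigmax_leqP => c /andP[jc lc].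
      have cm := ltn_ord c; rewrite [X in s X < _](_ : _ = j + (c - j)); last lia.
      have := ovj (c - j) b; rewrite /shift => ->; [exact: (ltn_trans lc lab) | lia | lia].
    have : f (s a) * m.+2 <= s (j + b) * m.+2 by rewrite leq_mul2r h orbT.
    rewrite mulSn; lia.
  - have h : f (s a) <= f (s b) by apply: f_mono; apply: ltnW.
    have : f (s a) * m.+2 <= f (s b) * m.+2 by rewrite leq_mul2r h orbT.
    lia.
apply: (@cluster_word_cnt _ _ x); last by rewrite o0 oj.
  by apply: localI; apply: local_occ; lia.
have inj0 a b : a < m -> b < m -> x a = x b -> a = b.
  move=> am bm; rewrite /x am bm => /eqP; rewrite eqn_mul2r /= => /eqP[]; exact: s_inj.
have sep a b : a < m -> m <= b < m + j -> x a <> x b.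
  move=> am /andP[bm bmj]; rewrite /x am ltnNge bm /= => /(congr1 (modn^~ m.+2)).
  rewrite modnMl modnMDl modn_small // ltnS ltnW // ltnS s_lt //; lia.
move=> a b aN bN xab; case: (ltnP a m) => am; case: (ltnP b m) => bm.
- exact: inj0.
- by case: (@sep a b); rewrite ?am ?bm.
- by case: (@sep b a); rewrite ?am ?bm.
move/occP: oj => so.
have [aj bj] : a = j + (a - j) /\ b = j + (b - j) by lia.
rewrite aj bj; congr (j + _); apply: s_inj; try lia.
have h1 := so (a - j) (b - j); have h2 := so (b - j) (a - j).
move: h1 h2; rewrite /shift -aj -bj xab ltnn -/s => h1 h2.
have {}h1 := h1 ltac:(lia) ltac:(lia); have {}h2 := h2 ltac:(lia) ltac:(lia).
lia.
Qed.

End Amalgam.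

Lemma wd_swap_last_two m (hm : 2 <= m) i : i < m ->
  wd (swap_last_two hm) i
  = if i == m - 2 then m - 1 else if i == m - 1 then m - 2 else i.
Proof.
move=> im; have [j ->] : exists j : 'I_m, i = j by exists (Ordinal im).
rewrite wdE /swap_last_two permE /= -!val_eqE /=.
by case: ifP => //= _; case: ifP.
Qed.

Lemma wd_rank n (p : 'S_n) i : i < n -> \sum_(k < n) (wd p k < wd p i) = wd p i.
Proof.
move=> im; have [j ->] : exists j : 'I_n, i = j by exists (Ordinal im).
rewrite [RHS]wdE -[RHS]perm_rank -sum1_card [RHS]big_mkcond.
by apply: eq_bigr => k _; rewrite inE !wdE; case: (_ < _).
Qed.

(** Further positions can only raise the rank of an entry. *)
Lemma occ0_le m (sigma : 'S_m) n (p : 'S_n) i : m <= n -> i < m ->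
  occ sigma 0 (wd p) -> wd sigma i <= wd p i.
Proof.
move=> mn im /occP o; rewrite -(wd_rank sigma im) -(wd_rank p (leq_trans im mn)).
rewrite (big_ord_widen n (fun k => nat_of_bool (wd sigma k < wd sigma i)) mn) big_mkcond.
by apply: leq_sum => k _; case: ifP => // km; rewrite -o.
Qed.

Section SwapLastTwo.
Variables (m : nat) (hm : 2 <= m).
Hypothesis m_gt2 : 2 < m.
Let tau := swap_last_two hm.
Let s := wd tau.

(** An overlap in two or more entries, but not all, would align the final descent with an earlier
    ascent. *)
Lemma swap_nonoverlap d : 0 < d < m.-1 -> ~~ ov tau d.
Proof.
move=> dm; apply/negP => /ordlikeP o.
have := o (m - 2 - d) (m - 1 - d); rewrite /shift /s !wd_swap_last_two; try lia.
rewrite (_ : d + (m - 2 - d) = m - 2); last lia.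
rewrite (_ : d + (m - 1 - d) = m - 1); last lia.
rewrite !eqxx; do ![case: eqP => ?]; lia.
Qed.

(* All entries of such a cluster except the one at position m - 2 form a chain,
   so the cluster is determined by that entry. *)
Lemma swap_pcl2_le : (pcl2 tau m.-1 <= m%:R / ((m + m.-1)`!)%:R)%R.
Proof.
apply: pr_le_cnt; pose N := m + m.-1; rewrite -/N.
have m0 : 0 < m by lia.
have sE i : i < m -> s i = if i == m - 2 then m - 1 else if i == m - 1 then m - 2 else i.
  exact: wd_swap_last_two.
have s_lt i : i < m -> s i < m by apply: wd_lt.
(* Ranks in the chain: the first m - 2 positions in order, then the second copy, whose lowest entry,
   at position m - 1, gets m - 2. *)
pose r i := if i < m - 2 then i else s (i - m.-1) + (m - 2).
have chain (p : 'S_N) : occ tau 0 (wd p) && occ tau m.-1 (wd p) ->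
    forall i k, i < N -> k < N -> i != m - 2 -> k != m - 2 -> (wd p i < wd p k) = (r i < r k).
  move=> /andP[/occP o0 /occP o1] i k iN kN.
  have {}o0 a b : a < m -> b < m -> (wd p a < wd p b) = (s a < s b) by apply: o0.
  have {}o1 a b : m.-1 <= a < N -> m.-1 <= b < N ->
      (wd p a < wd p b) = (s (a - m.-1) < s (b - m.-1)).
    move=> am bm; rewrite /s -o1 /shift; [|lia|lia].
    by congr (wd p _ < wd p _); lia.
  have lo a : a < m - 2 -> wd p a < wd p m.-1.
    by move=> am; rewrite o0 ?sE; try lia; do ?[case: eqP => ?]; lia.
  have hi a : m <= a < N -> wd p m.-1 < wd p a.
    move=> am; rewrite o1 ?subnn ?sE; try lia.
    by do ![case: eqP => ?]; lia.
  rewrite /r; case: (ltnP i (m - 2)) => i2; case: (ltnP k (m - 2)) => k2 ine kne.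
  - by rewrite o0 ?sE; try lia; do ?[case: eqP => ?]; lia.
  - have -> : wd p i < wd p k.
      have [->|kn] := eqVneq k m.-1; first exact: lo.
      by apply: ltn_trans (lo _ i2) (hi _ _); lia.
    by symmetry; lia.
  - have : wd p k < wd p i.
      have [->|kn] := eqVneq i m.-1; first exact: lo.
      by apply: ltn_trans (lo _ k2) (hi _ _); lia.
    by move/ltnW; rewrite ltnNge => ->; symmetry; lia.
  - by rewrite o1 ?ltn_add2r //; lia.
have e_lt : m - 2 < N by rewrite /N; lia.
have rankE (p : 'S_N) i : i < N -> i != m - 2 -> occ tau 0 (wd p) && occ tau m.-1 (wd p) ->
    wd p i = (wd p (m - 2) < wd p i) + \sum_(k < N | k != m - 2 :> nat) (r k < r i).
  move=> iN ine ev; rewrite -[LHS]wd_rank // (bigD1 (Ordinal e_lt)) //=; congr (_ + _).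
  apply: eq_big => [k|k kne]; first by rewrite -val_eqE.
  by rewrite (chain p).
(* The free entry exceeds the m - 1 others of the first copy, so its value is between m - 1 and 2m -
   2; the default of [insubd] does not arise on clusters. *)
pose f (p : 'S_N) : 'I_m := insubd (Ordinal m0) (wd p (m - 2) - m.-1).
have fE (p : 'S_N) : occ tau 0 (wd p) && occ tau m.-1 (wd p) -> wd p (m - 2) = f p + m.-1.
  move=> ev; have eN := wd_lt p e_lt.
  have := @occ0_le _ tau _ p (m - 2); rewrite -/s sE; last lia.
  rewrite eqxx => h; have {h} := h ltac:(rewrite /N; lia) ltac:(lia) ltac:(by case/andP: ev).
  rewrite /f val_insubd /N in eN * => h; rewrite ifT; lia.
rewrite -[leqRHS]card_ord; rewrite /cnt -(card_in_imset (f := f)); first exact: max_card.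
move=> p q; rewrite !inE => evp evq fpq; apply: same_order_perm.
have epq : wd p (m - 2) = wd q (m - 2) by rewrite !fE ?fpq.
have pq i : i < N -> wd p i = wd q i.
  move=> iN; have [->//|ine] := eqVneq i (m - 2).
  have := rankE p i iN ine evp; have := rankE q i iN ine evq.
  have pi : wd p i != wd p (m - 2) by apply/eqP => /(wd_inj iN e_lt) h; rewrite h eqxx in ine.
  have qi : wd q i != wd q (m - 2) by apply/eqP => /(wd_inj iN e_lt) h; rewrite h eqxx in ine.
  rewrite -epq in qi *; set c := \sum_(_ < _ | _) _.
  do 2 case: ltnP => /=; lia.
by move=> i k iN kN; rewrite !pq.
Qed.

End SwapLastTwo.

Lemma perm_of_word n (x : nat -> nat) :
    (forall i, i < n -> x i < n) ->
    (forall i j, i < n -> j < n -> x i = x j -> i = j) ->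
  exists p : 'S_n, forall i, i < n -> wd p i = x i.
Proof.
move=> xn xinj.
have finj : injective (fun i : 'I_n => Ordinal (xn i (ltn_ord i))).
  by move=> i j /(congr1 val) /= /xinj e; apply: val_inj; apply: e.
exists (perm finj) => i iN; have [j ->] : exists j : 'I_n, i = j by exists (Ordinal iN).
by rewrite wdE permE.
Qed.

(** * Interleavings of two chains with one common element *)

Section Merge.
Variables (x y : nat).
Implicit Types (A : {set 'I_x}) (B : {set 'I_y}).

(** The sorted values taken by one copy of the pattern: [A] below the shared value [x], then [x],
    then [B] counted from x + 1. The other copy uses the complements. *)
Definition merge A B : seq nat :=
  [seq val v | v <- enum A] ++ x :: [seq x.+1 + val v | v <- enum B].

Lemma pairwise_enum n (A : {set 'I_n}) : pairwise (relpre val ltn) (enum A).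
Proof.
have tr : transitive (relpre val ltn : rel 'I_n) by move=> ? ? ?; apply: ltn_trans.
rewrite -sorted_pairwise // /enum_mem -enumT; apply: sorted_filter => //.
by rewrite -sorted_map val_enum_ord iota_ltn_sorted.
Qed.

Lemma sorted_merge A B : sorted ltn (merge A B).
Proof.
rewrite sorted_pairwise; last exact: ltn_trans.
rewrite pairwise_cat /= !pairwise_map; apply/and4P; split.
- apply/allrelP => _ w /mapP[v _ ->]; rewrite inE => /orP[/eqP->|/mapP[v' _ ->]] //=.
  by rewrite ltnS ltnW // (leq_trans (ltn_ord v)) // leq_addr.
- exact: pairwise_enum.
- by apply/allP => _ /mapP[v _ ->]; rewrite /= addSn ltnS leq_addr.
apply: sub_pairwise (pairwise_enum B) => v w /=.
by rewrite ltn_add2l.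
Qed.

Lemma size_merge A B : size (merge A B) = (#|A| + #|B|).+1.
Proof. by rewrite size_cat /= !size_map -!cardE addnS. Qed.

Lemma nth_merge A B : nth 0 (merge A B) #|A| = x.
Proof. by rewrite nth_cat size_map -cardE ltnn subnn. Qed.

Lemma merge_bound A B v : v \in merge A B -> v < (x + y).+1.
Proof.
rewrite mem_cat inE => /or3P[/mapP[w _ ->]|/eqP->|/mapP[w _ ->]].
- by rewrite ltnS ltnW // (leq_trans (ltn_ord w)) // leq_addr.
- by rewrite ltnS leq_addr.
by rewrite addSn ltnS ltn_add2l ltn_ord.
Qed.

Lemma mem_merge_lo A B (v : 'I_x) : (val v \in merge A B) = (v \in A).
Proof.
rewrite mem_cat inE (mem_map val_inj) mem_enum (ltn_eqF (ltn_ord v)) /=.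
case: mapP => [[w _ e]|]; last by rewrite orbF.
by have := ltn_ord v; move: e => /= ->; lia.
Qed.

Lemma mem_merge_hi A B (v : 'I_y) : (x.+1 + val v \in merge A B) = (v \in B).
Proof.
rewrite mem_cat inE (_ : (_ == x) = false) /=; last by apply/eqP; lia.
case: mapP => [[w _ e]|_] /=.
  by have := ltn_ord w; move: e => /= <-; lia.
apply/mapP/idP => [[w]|vB]; last by exists v; rewrite ?mem_enum.
by rewrite mem_enum => wB /addnI/val_inj ->.
Qed.

Lemma merge_setC A B v : v \in merge A B -> v \in merge (~: A) (~: B) -> v = x.
Proof.
rewrite {1}mem_cat inE => /or3P[/mapP[w]|/eqP->//|/mapP[w]]; rewrite mem_enum => wA ->.
  by rewrite mem_merge_lo inE wA.
by rewrite mem_merge_hi inE wA.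
Qed.

Lemma nth_merge_lt A B i j : i < j -> j < size (merge A B) ->
  nth 0 (merge A B) i < nth 0 (merge A B) j.
Proof.
move=> ij js; apply: (sorted_ltn_nth ltn_trans 0 (sorted_merge A B)) => //.
by rewrite inE (ltn_trans ij).
Qed.

End Merge.

Section CrossingChains.
Variables (m : nat) (sigma : 'S_m).
Hypothesis m_gt1 : 1 < m.
Let s := wd sigma.
Let a := s 0.
Let b := s m.-1.
Let N := m + m.-1.
Let y := (m.-1 - a) + (m.-1 - b).

(* In two copies of [sigma] sharing one element c, b + a elements are smaller
   than c and y are larger; the choice of those in the first copy is free. *)
Lemma cross_cnt_ge :
  'C(a + b, b) * 'C(y, m.-1 - b)
  <= cnt (m + m.-1) (fun x => occ sigma 0 x && occ sigma m.-1 x).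
Proof.
have s_lt i : i < m -> s i < m by apply: wd_lt.
have s_inj i j : i < m -> j < m -> s i = s j -> i = j by apply: wd_inj.
have s_onto t : t < m -> exists2 i, i < m & s i = t.
  move=> tm; exists ((sigma^-1)%g (Ordinal tm)) => //.
  by rewrite /s wdE permKV.
have am : a < m by apply: s_lt; lia.
have bm : b < m by apply: s_lt; lia.
rewrite -[X in 'C(X, _) * _]card_ord -[X in _ * 'C(X, _)]card_ord -!card_draws -cardsX.
(* Reads off the values of the first copy below and above the shared value a + b; every pair of sets
   of the right sizes is shown to be attained. *)
pose h (p : 'S_N) := ([set v : 'I_(a + b) | [exists i : 'I_m, wd p i == v]],
  [set v : 'I_y | [exists i : 'I_m, wd p i == (a + b).+1 + v]]).
rewrite /cnt -/N; set E := [set p : 'S_N | _].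
apply: (leq_trans _ (leq_imset_card h E)); apply: subset_leq_card.
apply/subsetP => -[A B]; rewrite !inE /= => /andP[/eqP cA /eqP cB].
pose L1 := merge A B; pose L2 := merge (~: A) (~: B).
have cA' : #|~: A| = a by have := cardsC A; rewrite card_ord cA; lia.
have cB' : #|~: B| = m.-1 - a by have := cardsC B; rewrite card_ord cB /y; lia.
have s1 : size L1 = m by rewrite size_merge cA cB; lia.
have s2 : size L2 = m by rewrite size_merge cA' cB'; lia.
have n1 : nth 0 L1 b = a + b by have := nth_merge A B; rewrite cA.
have n2 : nth 0 L2 a = a + b by have := nth_merge (~: A) (~: B); rewrite cA'.
have in1 t : t < m -> nth 0 L1 t \in L1 by move=> tm; rewrite mem_nth ?s1.
have in2 t : t < m -> nth 0 L2 t \in L2 by move=> tm; rewrite mem_nth ?s2.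
(* Position m - 1 belongs to both copies; rank b in [L1] and rank a in [L2] give it the same value a
   + b. *)
pose x i := if i < m then nth 0 L1 (s i) else nth 0 L2 (s (i - m.-1)).
have x2 i : i < m -> x (m.-1 + i) = nth 0 L2 (s i).
  rewrite /x => im; rewrite addKn; case: ltnP => // mi.
  have -> : i = 0 by lia.
  by rewrite addn0 -/a -/b n1 n2.
have o0 : same_order m (shift 0 x) s.
  apply: same_order_mono => // i j im jm ij; rewrite /shift /x im jm.
  by apply: nth_merge_lt ij _; rewrite s1 s_lt.
have o1 : same_order m (shift m.-1 x) s.
  apply: same_order_mono => // i j im jm ij; rewrite /shift !x2 //.
  by apply: nth_merge_lt ij _; rewrite s2 s_lt.
have inj_of z : same_order m z s -> forall i j, i < m -> j < m -> z i = z j -> i = j.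
  move=> so i j im jm e; apply: s_inj => //.
  have := so i j im jm; have := so j i jm im; rewrite e ltnn; lia.
have sep i j : i < m -> 0 < j < m -> x i <> x (m.-1 + j).
  move=> im /andP[j0 jm]; rewrite x2 // {1}/x im => e.
  have e2 : nth 0 L2 (s j) = a + b.
    by apply: (merge_setC (A := A) (B := B)); rewrite -?e ?in1 ?s_lt // e in2 ?s_lt.
  have : j = 0; last by lia.
  by apply: (inj_of _ o1) => //; [lia | rewrite /shift !x2 -/a ?e2 ?n2 //; lia].
have [p px] : exists p : 'S_N, forall i, i < N -> wd p i = x i.
  apply: perm_of_word => [i iN|i j iN jN].
    have -> : N = (a + b + y).+1 by rewrite /N /y; lia.
    rewrite /x; case: (ltnP i m) => im.
      by apply: (@merge_bound _ _ A B); apply: in1; apply: s_lt.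
    by apply: (@merge_bound _ _ (~: A) (~: B)); apply: in2; apply: s_lt; rewrite /N in iN; lia.
  rewrite /N in iN jN => e.
  case: (ltnP i m) => im; case: (ltnP j m) => jm.
  - exact: (inj_of _ o0).
  - case: (@sep i (j - m.-1)); rewrite ?im //; first lia.
    by rewrite e; congr x; lia.
  - case: (@sep j (i - m.-1)); rewrite ?jm //; first lia.
    by rewrite -e; congr x; lia.
  have : i - m.-1 = j - m.-1; last lia.
  apply: (inj_of _ o1); try lia.
  by rewrite /shift !subnKC //; lia.
apply/imsetP; exists p.
  rewrite inE; apply/andP; split; apply/occP => i j im jm; rewrite /shift !px /N; try lia.
    exact: o0.
  exact: o1.
have mem1 v : [exists i : 'I_m, wd p i == v] = (v \in L1).
  apply/existsP/idP => [[i /eqP <-]|/(nthP 0)[t]].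
    rewrite px; last by rewrite /N; have := ltn_ord i; lia.
    by rewrite /x ltn_ord in1 ?s_lt.
  rewrite s1 => /s_onto[i im <-] <-; exists (Ordinal im); rewrite /= px /N; last lia.
  by rewrite /x im.
by congr (_, _); apply/setP => v; rewrite inE mem1 ?mem_merge_lo ?mem_merge_hi.
Qed.

End CrossingChains.

(** * Patterns with the same end entries *)

Section InclusionExclusion.
Variables (T I : finType).
Implicit Types E F : I -> pred T.

(* Inclusion-exclusion, from the expansion of prod_i (1 - [E i x]). *)
Lemma card_none_sum E : (#|[set x | [forall i, ~~ E i x]]|%:R : int)%R
  = (\sum_(S : {set I}) (\prod_i (if i \in S then -1 else 1))
       * #|[set x | [forall (i | i \in S), E i x]]|%:R)%R.
Proof.
have cE (P : pred T) : (#|[set x | P x]|%:R = \sum_x (P x)%:R :> int)%R.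
  rewrite -sum1_card natr_sum big_mkcond; apply: eq_bigr => x _.
  by rewrite inE; case: (P x).
rewrite cE.
under [RHS]eq_bigr => S _ do rewrite cE mulr_sumr.
rewrite exchange_big; apply: eq_bigr => x _.
transitivity (\prod_i (- (E i x)%:R + 1) : int)%R.
  case: (boolP [forall i, ~~ E i x]) => [/forallP h|/forallPn[i]].
    by rewrite big1 // => i _; rewrite (negbTE (h i)) oppr0 add0r.
  rewrite negbK => Ei.
  by rewrite (bigD1 i) //= Ei addNr mul0r.
rewrite bigA_distr /=; apply: eq_bigr => S _.
case: (boolP [forall (i | i \in S), E i x]) => [/forall_inP h|].
  by rewrite mulr1; apply: eq_bigr => i _; case: ifP => // /h ->.
rewrite mulr0 => /forall_inPn[i iS /negbTE Ei].
by rewrite (bigD1 i) //= iS Ei oppr0 mul0r.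
Qed.

Lemma eq_card_none E F :
    (forall S : {set I}, #|[set x | [forall (i | i \in S), E i x]]|
                       = #|[set x | [forall (i | i \in S), F i x]]|) ->
  #|[set x | [forall i, ~~ E i x]]| = #|[set x | [forall i, ~~ F i x]]|.
Proof.
move=> h; apply/eqP; rewrite -(eqr_nat int) !card_none_sum; apply/eqP.
by apply: eq_bigr => S _; rewrite h.
Qed.

End InclusionExclusion.

Section SameEnds.
Variables (m n : nat) (S : {set 'I_n.+1}).
Implicit Types sigma tau rho : 'S_m.

Definition separated :=
  [forall (i | i \in S), [forall (i' | i' \in S), (i < i') ==> (i + m.-1 <= i')]]
  && [forall (i | i \in S), i + m <= n].

(* Rearranges the interior of the blocks starting in [S]; adjacent blocks share at
   most an end entry, which rho is going to fix. *)
Definition block_move rho k :=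
  if [pick i in S | i <= k < i + m.-1] is Some i then i + wd rho (k - i) else k.

Lemma block_moveE rho (i : 'I_n.+1) a : separated -> i \in S -> a < m.-1 ->
  block_move rho (i + a) = i + wd rho a.
Proof.
move=> /andP[/forall_inP sep _] iS am; rewrite /block_move.
case: pickP => [i' /and3P[i'S h1 h2]|/(_ i)]; last first.
  by rewrite iS /= leq_addr ltn_add2l am.
have /forall_inP/(_ i iS)/implyP s1 := sep i' i'S.
have /forall_inP/(_ i' i'S)/implyP s2 := sep i iS.
have -> : i' = i.
  apply: val_inj => /=; case: (ltngtP (i : nat) i') => // [/s2|/s1]; lia.
by rewrite addKn.
Qed.

(** Moving the blocks by the inverse of [rho] undoes the move, so it is a permutation of the
    positions. *)
Lemma block_perm rho : 1 < m -> separated -> wd rho 0 = 0 -> wd rho m.-1 = m.-1 ->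
  exists theta : 'S_n, forall (i : 'I_n.+1) a, i \in S -> a < m -> wd theta (i + a) = i + wd rho a.
Proof.
move=> m1 sep r0 r1.
have rlt (r : 'S_m) a : wd r m.-1 = m.-1 -> a < m.-1 -> wd r a < m.-1.
  move=> {}r1 am; have am' : a < m by lia.
  have := wd_lt r am'; have : wd r a <> m.-1; last by lia.
  by rewrite -{1}r1 => /wd_inj e; have := e am' ltac:(lia); lia.
have bound (i : 'I_n.+1) : i \in S -> i + m <= n by move: sep => /andP[_ /forall_inP h] /h.
have out (r : 'S_m) k : ~~ [exists i in S, i <= k < i + m.-1] -> block_move r k = k.
  by move=> /exists_inPn h; rewrite /block_move; case: pickP => // i /andP[/h /negP].
have blk k : [exists i in S, i <= k < i + m.-1] ->
    exists i : 'I_n.+1, exists2 a, i \in S /\ a < m.-1 & k = i + a.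
  move=> /exists_inP[i iS ik]; exists i; exists (k - i); last by lia.
  by split=> //; lia.
have ri1 : wd rho^-1%g m.-1 = m.-1.
  rewrite -{1}r1 -wdM ?mulgV; last lia.
  by rewrite /wd; case: insubP => [j _ <-|]; rewrite ?perm1 //; lia.
have moveK k : block_move rho^-1%g (block_move rho k) = k.
  have [/blk[i [a [iS am] ->]]|h] := boolP [exists i in S, i <= k < i + m.-1]; last by rewrite !out.
  rewrite !block_moveE ?rlt // -wdM ?mulgV; last lia.
  by congr (_ + _); have am' : a < m by [lia]; rewrite -[a]/(val (Ordinal am')) wdE perm1.
have [|i j _ _ /(can_inj moveK)//|theta thE] := @perm_of_word n (block_move rho).
  move=> k kn; have [/blk[i [a [iS am] kE]]|h] := boolP [exists i in S, i <= k < i + m.-1].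
    by rewrite kE block_moveE //; have := bound i iS; have := rlt rho a r1 am; lia.
  by rewrite out.
exists theta => i a iS am; have ibd := bound i iS; rewrite thE; last lia.
have [am'|ma] := ltnP a m.-1; first exact: block_moveE.
have {ma am} -> : a = m.-1 by lia.
(* The last entry of a block is either left in place or is the first entry of the next block, which
   [rho] fixes. *)
rewrite r1; have [/blk[i' [a' [i'S am] e]]|h] := boolP [exists i' in S, i' <= i + m.-1 < i' + m.-1].
  rewrite e block_moveE //; suff -> : a' = 0 by rewrite r0.
  move: sep => /andP[/forall_inP sep _].
  have /forall_inP/(_ i iS)/implyP s1 := sep i' i'S.
  have /forall_inP/(_ i' i'S)/implyP s2 := sep i iS.
  case: (ltngtP (i : nat) i') => [/s2|/s1|]; lia.
by rewrite out.
Qed.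

Definition occurs_on sigma (p : 'S_n) (i : 'I_n.+1) := (i + m <= n) && occ sigma i (wd p).

(** If some permutation has [sigma] at all starts in [S], these starts are separated. Rearranging
    each block by [rho], which carries [sigma] to [tau] and fixes both ends, is then an injection
    into the permutations with [tau] at those starts. *)
Lemma card_occurs_on_le sigma tau : 1 < m -> (forall d, 0 < d < m.-1 -> ~~ ov sigma d) ->
    wd sigma 0 = wd tau 0 -> wd sigma m.-1 = wd tau m.-1 ->
  #|[set p : 'S_n | [forall (i | i \in S), occurs_on sigma p i]]|
  <= #|[set p : 'S_n | [forall (i | i \in S), occurs_on tau p i]]|.
Proof.
move=> m1 nov e0 e1; set A := [set p | _].
have [->|[p0]] := set_0Vmem A; first by rewrite cards0.
rewrite inE => /forall_inP p0S.
have sep : separated.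
  apply/andP; split; last by apply/forall_inP => i /p0S /andP[].
  apply/forall_inP => i /p0S /andP[_ oi]; apply/forall_inP => i' /p0S /andP[_ oi'].
  apply/implyP => ii'; rewrite leqNgt; apply/negP => lt.
  have dE : (i' : nat) = i + (i' - i) by lia.
  have := nov (i' - i) ltac:(lia); rewrite dE in oi'.
  by rewrite (occ_ov oi oi').
pose rho := (tau * sigma^-1)%g.
have rhoE a : a < m -> wd sigma (wd rho a) = wd tau a.
  by move=> am; rewrite -wdM // mulgKV.
have [r0 r1] : wd rho 0 = 0 /\ wd rho m.-1 = m.-1.
  by split; apply: (@wd_inj _ sigma); rewrite ?wd_lt ?rhoE //; lia.
have [theta thE] := block_perm m1 sep r0 r1.
rewrite -(card_imset _ (mulgI theta)); apply: subset_leq_card.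
apply/subsetP => _ /imsetP[p pA ->]; rewrite inE in pA; move/forall_inP: pA => pS.
rewrite inE; apply/forall_inP => i iS; have /andP[ibd /occP o] := pS i iS.
rewrite /occurs_on ibd; apply/occP => a b am bm; rewrite /shift !wdM; try lia.
rewrite !thE // -!rhoE // -o ?wd_lt //.
Qed.

End SameEnds.

Lemma alpha_same_ends m (sigma tau : 'S_m) n : 1 < m ->
    (forall d, 0 < d < m.-1 -> ~~ ov sigma d) -> (forall d, 0 < d < m.-1 -> ~~ ov tau d) ->
    wd sigma 0 = wd tau 0 -> wd sigma m.-1 = wd tau m.-1 ->
  alpha n sigma = alpha n tau.
Proof.
move=> m1 nos not e0 e1.
have aE (s : 'S_m) : alpha n s
    = #|[set p : 'S_n | [forall i : 'I_n.+1, ~~ occurs_on s p i]]|.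
  apply: eq_card => p; rewrite !inE /avoids negb_exists.
  by apply: eq_forallb => i; rewrite occurs_atE.
rewrite !aE; apply: (eq_card_none (E := fun i p => occurs_on sigma p i)
  (F := fun i p => occurs_on tau p i)) => S.
by apply/eqP; rewrite eqn_leq !card_occurs_on_le.
Qed.

(** * Reversal and complement *)

Section Symmetries.

(** As a left factor it reverses the word, as a right factor it complements the entries. *)
Definition revp n : 'S_n := perm (@rev_ord_inj n).

Lemma wd_revp n i : i < n -> wd (revp n) i = n.-1 - i.
Proof.
move=> iN; have [j ->] : exists j : 'I_n, i = j by exists (Ordinal iN).
by rewrite wdE permE /=; lia.
Qed.

Variables (m : nat) (sigma : 'S_m).

Lemma alpha_rev n : alpha n sigma <= alpha n (revp m * sigma)%g.
Proof.
rewrite !alphaE /cnt -(card_imset _ (mulgI (revp n))); apply: subset_leq_card.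
apply/subsetP => _ /imsetP[p + ->]; rewrite !inE => /avoidP a.
apply/avoidP => i imn; have := a (n - m - i) ltac:(lia); apply: contra => /occP o.
apply/occP => c d cm dm; rewrite /shift.
have := o (m.-1 - c) (m.-1 - d) ltac:(lia) ltac:(lia).
rewrite /shift !wdM ?wd_revp; try lia.
rewrite (_ : n.-1 - (i + (m.-1 - c)) = n - m - i + c); last lia.
rewrite (_ : n.-1 - (i + (m.-1 - d)) = n - m - i + d); last lia.
by rewrite !subKn //; lia.
Qed.

Lemma alpha_comp n : alpha n sigma <= alpha n (sigma * revp m)%g.
Proof.
rewrite !alphaE /cnt -(card_imset _ (mulIg (revp n))); apply: subset_leq_card.
apply/subsetP => _ /imsetP[p + ->]; rewrite !inE => /avoidP a.
apply/avoidP => i imn; have := a i imn; apply: contra => /occP o.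
apply/occP => c d cm dm; rewrite /shift.
have [lc ld] : wd sigma c < m /\ wd sigma d < m by split; apply: wd_lt.
have [ic jd] : i + c < n /\ i + d < n by lia.
have := o d c dm cm; rewrite /shift !wdM ?wd_revp ?wd_lt //.
have := wd_lt p ic; have := wd_lt p jd; lia.
Qed.

Lemma ov_rev d : ov (revp m * sigma)%g d -> ov sigma d.
Proof.
move=> /ordlikeP o; apply/ordlikeP => a b am bm; rewrite /shift.
have := o (m.-1 - d - a) (m.-1 - d - b) ltac:(lia) ltac:(lia).
rewrite /shift !wdM ?wd_revp; try lia.
rewrite (_ : m.-1 - (d + (m.-1 - d - a)) = a); last lia.
rewrite (_ : m.-1 - (d + (m.-1 - d - b)) = b); last lia.
rewrite (_ : m.-1 - (m.-1 - d - a) = d + a); last lia.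
by rewrite (_ : m.-1 - (m.-1 - d - b) = d + b) //; lia.
Qed.

Lemma ov_comp d : ov (sigma * revp m)%g d -> ov sigma d.
Proof.
move=> /ordlikeP o; apply/ordlikeP => a b am bm; rewrite /shift.
have lt i : i < m -> wd sigma i < m by apply: wd_lt.
have := o b a bm am; rewrite /shift !wdM ?wd_revp ?lt; try lia.
have := lt a ltac:(lia); have := lt b ltac:(lia).
have := lt (d + a) ltac:(lia); have := lt (d + b) ltac:(lia); lia.
Qed.

End Symmetries.

(** * Clusters of three occurrences for short patterns *)

Section Enumeration.
Variables (N : nat) (starts : seq nat) (s : seq nat).

(** Tests only comparisons that lie inside the prefix [w], so every prefix of a solution passes and
    the search is pruned early. *)
Definition consistent (w : seq nat) : bool :=
  uniq w && all (fun t => all (fun b => (t + b < size w) ==> all (fun a =>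
    (nth 0 w (t + a) < nth 0 w (t + b)) == (nth 0 s a < nth 0 s b))
    (iota 0 b)) (iota 0 (size s))) starts.

Fixpoint words (k : nat) : seq (seq nat) :=
  if k is k'.+1 then
    flatten [seq [seq rcons w v | v <- iota 0 N & consistent (rcons w v)] | w <- words k']
  else [:: [::]].

Lemma mem_words k (x : nat -> nat) : (forall i, i < k -> x i < N) ->
  (forall i, i <= k -> consistent (mkseq x i)) -> mkseq x k \in words k.
Proof.
elim: k => [|k IH] xN xc //=; rewrite mkseqS.
apply/flatten_mapP; exists (mkseq x k).
  by apply: IH => i ik; [apply: xN; apply: leqW | apply: xc; apply: leqW].
apply/mapP; exists (x k) => //; rewrite mem_filter mem_iota /= add0n xN // andbT.
by rewrite -mkseqS xc.
Qed.

Lemma cnt_le_words m (sigma : 'S_m) : s = mkseq (wd sigma) m ->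
    all (fun t => t + m <= N) starts ->
  cnt N (fun x => all (fun t => occ sigma t x) starts) <= size (words N).
Proof.
move=> sE /allP startsN; rewrite /cnt cardE.
rewrite -(size_map (fun p : 'S_N => mkseq (wd p) N)); apply: uniq_leq_size.
  rewrite map_inj_uniq ?enum_uniq // => p q e.
  have pq i : i < N -> wd p i = wd q i.
    by move=> iN; have := congr1 (nth 0 ^~ i) e; rewrite !nth_mkseq.
  by apply: same_order_perm => i j iN jN; rewrite !pq.
move=> _ /mapP[p + ->]; rewrite mem_enum inE => /allP po.
apply: mem_words => [i iN|k kN]; first exact: wd_lt.
rewrite /consistent; apply/andP; split.
  by apply/mkseq_uniqP => i j; rewrite !inE => ik jk; apply: wd_inj; apply: leq_trans kN.
apply/allP => t ts; apply/allP => b; rewrite sE size_mkseq mem_iota => /= bm.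
apply/implyP; rewrite size_mkseq => tb; apply/allP => a; rewrite mem_iota /= => ab.
have am : a < m by apply: ltn_trans ab bm.
rewrite !nth_mkseq // ?(occP _ _ _ (po t ts)) //.
by apply: leq_ltn_trans tb; rewrite leq_add2l ltnW.
Qed.

End Enumeration.

(** Without prescribed starts the enumeration contains all permutations, so a computed check over it
    covers every pattern. *)
Lemma mkseq_words m (sigma : 'S_m) : mkseq (wd sigma) m \in words m [::] [::] m.
Proof.
apply: mem_words => [i|i im]; first exact: wd_lt.
rewrite /consistent andbT; apply/mkseq_uniqP => a b; rewrite !inE => ai bi.
by apply: wd_inj; apply: leq_trans im.
Qed.

Lemma triple_cnt_le m N starts c : all (fun t => t + m <= N) starts ->
    all (fun s => size (words N starts s N) <= c) (words m [::] [::] m) ->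
  forall sigma : 'S_m, cnt N (fun x => all (fun t => occ sigma t x) starts) <= c.
Proof.
move=> sN /allP h sigma; apply: leq_trans (h _ (mkseq_words sigma)).
exact: cnt_le_words.
Qed.

(** For lengths 3 and 4 the factor 1/2! from [pcl3_le] is too large for the later estimates, so
    these clusters are counted by computation. *)
Lemma pcl3_3 (sigma : 'S_3) : (pcl3 sigma 2 1 <= 1 / (6`!)%:R)%R.
Proof.
apply: (@pr_le_cnt 6 _ 1); apply: leq_trans (@triple_cnt_le 3 6 [:: 0; 2; 3] 1 _ _ sigma).
- by apply: subset_leq_card; apply/subsetP => p; rewrite !inE /= andbT.
- by [].
by vm_compute.
Qed.

Lemma pcl3_4 (sigma : 'S_4) : (pcl3 sigma 2 2 <= 5%:R / (8`!)%:R)%R.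
Proof.
apply: (@pr_le_cnt 8 _ 5); apply: leq_trans (@triple_cnt_le 4 8 [:: 0; 2; 4] 5 _ _ sigma).
- by apply: subset_leq_card; apply/subsetP => p; rewrite !inE /= andbT.
- by [].
by vm_compute.
Qed.

(** * Numerical bounds *)

Section Numeric.
Local Open Scope ring_scope.

Lemma factS_rat n : ((n.+1)`!)%:R = n.+1%:R * (n`!)%:R :> rat.
Proof. by rewrite factS natrM. Qed.

(** Telescoping: 1/n! <= (4/3)(1/n! - 1/(n+1)!) for n >= 3, and 2/9 = (4/3)/3!. *)
Lemma sum_inv_fact n : (3 <= n)%N ->
  \sum_(3 <= s < n) (s`!%:R)^-1 <= 2%:R / 9%:R - (4%:R / 3%:R) / (n`!)%:R :> rat.
Proof.
move=> /subnK <-; elim: (n - 3)%N => [|{}n IH].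
  rewrite add0n big_geq; last by [].
  by have -> : (3`! = 6)%N by []; lra.
rewrite addSn big_nat_recr; last exact: leq_addl.
rewrite /=.
have := IH.
rewrite factS_rat invfM.
set x := (((n + 3)`!)%:R^-1 : rat) => h.
have x0 : 0 <= x by rewrite invr_ge0 ler0n.
have h2 : (n + 3).+1%:R^-1 <= 4%:R^-1 :> rat.
  by rewrite lef_pV2 ?posrE ?ltr0n ?ler_nat ?addnS ?addn2.
have := ler_wpM2r x0 h2.
set y := (n + 3).+1%:R^-1 in h2 *; lra.
Qed.

(* The quotient of the two factorials is at least 2m-1 if d = 1 and at least
   (2m-1)(2m-2) if d > 1. *)
Lemma fact_ratio m j (d := (m.-1 - j)%N) (Z : rat) : (3 <= m)%N -> (0 < j < m.-1)%N ->
    1 <= Z -> Z ^+ m <= 3%:R / 2%:R -> m%:R * Z <= m%:R + 3%:R^-1 ->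
  m%:R / ((m + m.-1)`!)%:R * Z ^+ d <= 2%:R / 3%:R * (1 / ((m + j)`!)%:R).
Proof.
move=> m3 jm Z1 Zm mZ.
have m3' : 3%:R <= m%:R :> rat by rewrite ler_nat.
have F0 n : 0 < (n`!)%:R :> rat by rewrite ltr0n fact_gt0.
have Z0 : 0 <= Z by lra.
suff [K [KF mK]] : exists K : nat, (K * (m + j)`! <= (m + m.-1)`!)%N
    /\ m%:R * Z ^+ d <= 2%:R / 3%:R * K%:R.
  have KG : K%:R <= ((m + m.-1)`!)%:R / ((m + j)`!)%:R :> rat.
    by rewrite ler_pdivlMr ?F0 // -natrM ler_nat.
  rewrite mulrAC ler_pdivrMr; last exact: F0.
  rewrite [leRHS](_ : _ = 2%:R / 3%:R * (((m + m.-1)`!)%:R / ((m + j)`!)%:R)); last by ring.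
  by lra.
have [d1|d2] : d = 1%N \/ (2 <= d)%N by rewrite /d; lia.
  have mE : (m + m.-1 = (m + j).+1)%N by rewrite /d in d1; lia.
  exists (m + m.-1)%N; split; first by rewrite mE factS.
  rewrite d1 expr1 (_ : (m + m.-1)%:R = 2%:R * m%:R - 1); first lra.
  have -> : (m + m.-1 = (m + m) - 1)%N by lia.
  by rewrite natrB ?natrD; [lra | lia].
have [mE mE'] : (m + m.-1 = (m + m.-2).+1)%N /\ (m + m.-2 = (m + m.-1.-2).+1)%N.
  by rewrite /d in d2; lia.
exists ((m + m.-1) * (m + m.-2))%N; split.
  rewrite {2}mE factS -mE -mulnA leq_mul2l; apply/orP; right.
  rewrite {2}mE' factS -mE' leq_mul2l; apply/orP; right.
  by apply: leq_fact; rewrite /d in d2; lia.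
have Zd : Z ^+ d <= 3%:R / 2%:R.
  by apply: le_trans Zm; rewrite ler_weXn2l // /d; lia.
have : m%:R * Z ^+ d <= m%:R * (3%:R / 2%:R) by rewrite ler_wpM2l.
have : ((9 * m)%:R : rat) <= (4 * ((m + m.-1) * (m + m.-2)))%:R by rewrite ler_nat; nia.
rewrite !natrM; lra.
Qed.

(** The growth condition of [recurrence_ge0] for Z = 1 + 1/(3m): the power is at most 3/2, and m! >=
    6m because (m-1)! >= 3!. *)
Lemma pow_div_fact m : (4 <= m)%N ->
  1 / (m`!)%:R * (1 + (3 * m%:R)^-1) ^+ m <= (1 + (3 * m%:R)^-1) - 1 :> rat.
Proof.
move=> m4; have m0 : 0 < m%:R :> rat by rewrite ltr0n; lia.
have f0 : 0 < (m`!)%:R :> rat by rewrite ltr0n fact_gt0.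
have := @pow_1Dinv m ltac:(lia); set y := (_ ^+ _) => yle.
apply: (@le_trans _ _ (1 / (m`!)%:R * (3%:R / 2%:R))).
  by rewrite ler_wpM2l // divr_ge0 // ltW.
have h : (6 * m)%:R <= (m`!)%:R :> rat.
  rewrite ler_nat; case: m m4 {m0 f0 y yle} => // k k4.
  by rewrite factS mulnC leq_mul2l /= (@leq_fact 3).
have m6 : 0 < (6 * m)%:R :> rat by rewrite ltr0n; lia.
move: h; rewrite -lef_pV2 ?posrE // natrM !invfM => h.
have : 0 <= m%:R^-1 :> rat by rewrite invr_ge0 ltW.
by lra.
Qed.

End Numeric.

Section Gap.
Local Open Scope ring_scope.
Variable m : nat.
Hypothesis m_ge4 : (4 <= m)%N.
Let Z : rat := 1 + (3 * m%:R)^-1.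
Let q : rat := m%:R / ((m + m.-1)`!)%:R.

Let m0 : 0 < m%:R :> rat. Proof. by rewrite ltr0n; lia. Qed.
Let Z_ge1 : 1 <= Z.
Proof. by rewrite lerDl invr_ge0 mulr_ge0 ?ler0n. Qed.
Let Z0 : 0 <= Z. Proof. exact: le_trans ler01 Z_ge1. Qed.
Let Zm : Z ^+ m <= 3%:R / 2%:R. Proof. by apply: pow_1Dinv; lia. Qed.
Let Zk k : (k <= m)%N -> Z ^+ k <= 3%:R / 2%:R.
Proof. by move=> km; apply: le_trans Zm; rewrite ler_weXn2l. Qed.
Let mZ : m%:R * Z <= m%:R + 3%:R^-1.
Proof. by rewrite /Z mulrDr mulr1 invfM mulrCA divff ?mulr1 ?lt0r_neq0. Qed.

Variable sigma : 'S_m.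

(** The q term takes at most 2/3 of [pcl2 sigma j], and the triple clusters at most (3/2)(2/9) = 1/3
    of it. *)
Lemma gap_overlap j : (0 < j < m.-1)%N -> ov sigma j ->
    (forall d, (0 < d < j)%N -> ~~ ov sigma d) -> (4 < m)%N || (j < 2)%N ->
  q * Z ^+ (m.-1 - j) + \sum_(m - j <= s < m) Z ^+ s * pcl3 sigma s j <= pcl2 sigma j.
Proof.
move=> jm ovj jmin nm4.
have x0 : 1 / ((m + j)`!)%:R <= pcl2 sigma j by apply: pcl2_ov_ge => //; lia.
have := @fact_ratio m j Z ltac:(lia) jm Z_ge1 Zm mZ; rewrite -/q => h1.
have x1 : 0 <= pcl2 sigma j by apply: pr_ge0.
suff h2 : \sum_(m - j <= s < m) Z ^+ s * pcl3 sigma s j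
    <= (3%:R / 2%:R * pcl2 sigma j) * (2%:R / 9%:R) by lra.
pose g s : rat := if (3 <= s)%N then (s`!%:R)^-1 else 0.
apply: (@le_trans _ _ (\sum_(m - j <= s < m) (3%:R / 2%:R * pcl2 sigma j) * g s)).
  apply: ler_sum_nat => s /andP[sj sm]; rewrite /g; have [s3|s3] := leqP 3 s; last first.
    (* If m > 4 or j < 2, then m - j <= s < 3 forces s < j, where minimality of j excludes an
       overlap. *)
    have -> : pcl3 sigma s j = 0 by apply: pcl3_ov; apply: jmin; lia.
    by rewrite !mulr0.
  have s3le := pcl3_le sigma j (ltnW sm).
  rewrite -mulrA; apply: ler_pM; [exact: exprn_ge0|exact: pr_ge0| |exact: s3le].
  by apply: Zk; apply: ltnW.
rewrite -mulr_sumr; apply: ler_wpM2l; first by apply: mulr_ge0; [lra | exact: x1].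
have g0 s : 0 <= g s by rewrite /g; case: ifP => // _; rewrite invr_ge0 ler0n.
apply: (@le_trans _ _ (\sum_(0 <= s < m) g s)).
  rewrite [leRHS](@big_cat_nat _ _ _ (m - j)) ?leq_subr //= lerDr.
  by rewrite sumr_ge0.
rewrite (@big_cat_nat _ _ _ 3); [rewrite /=|exact: isT|lia].
rewrite [X in X + _]big_nat_cond big1 => [|s /andP[/andP[_ s3] _]]; last first.
  by rewrite /g leqNgt s3.
rewrite add0r (@eq_big_nat _ _ _ _ _ _ (fun s => (s`!%:R)^-1)) => [|s /andP[s3 _]]; last first.
  by rewrite /g s3.
have := @sum_inv_fact m ltac:(lia).
have : 0 <= (m`!)%:R^-1 :> rat by rewrite invr_ge0 ler0n.
by lra.
Qed.

(** Only s = m - 1 survives in the sum; it takes at most (3/2)/3! = 1/4 of [pcl2], and q at most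
    1/2. *)
Lemma gap_cross : (forall d, (0 < d < m.-1)%N -> ~~ ov sigma d) -> 2%:R * q <= pcl2 sigma m.-1 ->
  q * Z ^+ (m.-1 - m.-1) + \sum_(m - m.-1 <= s < m) Z ^+ s * pcl3 sigma s m.-1
    <= pcl2 sigma m.-1.
Proof.
move=> nov q2; rewrite subnn mulr1.
have x1 : 0 <= pcl2 sigma m.-1 by apply: pr_ge0.
rewrite (_ : m - m.-1 = 1)%N; last lia.
rewrite [X in index_iota _ X](_ : m = m.-1.+1); last lia.
rewrite big_nat_recr /=; last lia.
rewrite big_nat_cond big1 ?add0r => [|s /andP[sm _]]; last by rewrite pcl3_ov ?mulr0 ?nov.
have : Z ^+ m.-1 * pcl3 sigma m.-1 m.-1 <= (3%:R / 2%:R) * (pcl2 sigma m.-1 / 6%:R).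
  apply: ler_pM; rewrite ?exprn_ge0 ?pr_ge0 ?Zk ?leq_pred //.
  apply: le_trans (pcl3_le _ _ (leq_pred m)) _; rewrite ler_wpM2l //.
  by rewrite lef_pV2 ?posrE ?ltr0n ?fact_gt0 // ler_nat (@leq_fact 3); lia.
by lra.
Qed.

End Gap.

Section Gap4.
Local Open Scope ring_scope.

(** The case left out by [gap_overlap]: the term s = 2 is bounded by enumeration, the term s = 3 by
    1/3!. *)
Lemma gap_4 (sigma : 'S_4) (Z := 1 + (3 * 4%:R)^-1 : rat) : ov sigma 2 ->
  4%:R / ((4 + 4.-1)`!)%:R * Z ^+ (4.-1 - 2) + \sum_(4 - 2 <= s < 4) Z ^+ s * pcl3 sigma s 2
    <= pcl2 sigma 2.
Proof.
have e6 : (4 + 2 = 6)%N := erefl.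
have e7 : (4 + 4.-1 = 7)%N := erefl.
have e1 : (4.-1 - 2 = 1)%N := erefl.
have ZE : Z = 13%:R / 12%:R by rewrite /Z; field.
have sE (F : nat -> rat) : \sum_(4 - 2 <= s < 4) F s = F 2 + F 3.
  have -> : (4 - 2 = 2)%N := erefl.
  rewrite big_ltn; last exact: isT.
  rewrite big_ltn; last exact: isT.
  by rewrite big_geq; [rewrite addr0; exact: erefl | exact: isT].
move=> ov2; pose f n : rat := (n`!)%:R^-1.
have fS n : f n.+1 = n.+1%:R^-1 * f n by rewrite /f factS_rat invfM.
have w0 : 0 < f 6 by rewrite invr_gt0 fact_gt0R.
have x1 : 1 * f (4 + 2)%N <= pcl2 sigma 2 by exact: (@pcl2_ov_ge 4 sigma 2 isT ov2).
have y1 : pcl3 sigma 2 2 <= 5%:R * f 8 by exact: pcl3_4.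
have z1 : pcl3 sigma 3 2 <= pcl2 sigma 2 * f 3 by exact: (@pcl3_le 4 sigma 3 2 isT).
have f3 : f 3 = 6%:R^-1 by [].
have f8 : f 8 = 8%:R^-1 * f 7 := fS 7.
have f7 : f 7 = 7%:R^-1 * f 6 := fS 6.
rewrite sE -/(f (4 + 4.-1)%N) e7 e1 ZE expr1 expr2 exprS expr2.
move: w0 x1 y1 z1; rewrite e6 f3 f8 f7 {f3 f8 f7 fS ZE sE}.
move: (f 6) (pcl3 _ _ _) (pcl3 _ _ _) (pcl2 _ _) => {f Z} w x y z; lra.
Qed.

End Gap4.

(** * Comparison of the two patterns *)

Section Assembly.
Local Open Scope ring_scope.

Lemma pav_diff_rec m (sigma tau : 'S_m) q : (1 < m)%N ->
    (forall d, (0 < d < m.-1)%N -> ~~ ov tau d) -> pcl2 tau m.-1 <= q ->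
    (forall n, pav sigma n - 1 / (m`!)%:R * back (pav sigma) n.+1 m
       + q * back (pav sigma) n.+1 (m + m.-1) <= pav sigma n.+1) ->
  let u n := pav sigma n - pav tau n in
  forall n, u n - 1 / (m`!)%:R * back u n.+1 m + q * back u n.+1 (m + m.-1) <= u n.+1.
Proof.
move=> m1 nov tq low u n.
have q0 : 0 <= q by apply: le_trans tq; apply: pr_ge0.
have backB d : back u n.+1 d = back (pav sigma) n.+1 d - back (pav tau) n.+1 d.
  by rewrite /back; case: ifP => // _; rewrite subr0.
have tb : 0 <= back (pav tau) n.+1 (m + m.-1) by apply: back_ge0 => k; apply: pr_ge0.
have up : pav tau n.+1 <= pav tau n - 1 / (m`!)%:R * back (pav tau) n.+1 m
       + q * back (pav tau) n.+1 (m + m.-1).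
  have [mn|nm] := leqP m n.+1.
    apply: (le_trans (pav_upper _ nov mn)); first by lia.
    rewrite {2}/back mn mul1r [_^-1 * _]mulrC lerD2l mulrC.
    by rewrite ler_wpM2r.
  rewrite !pav_small //; last exact: ltnW.
  rewrite /back !ifF ?mulr0 ?subr0 ?addr0 //; lia.
rewrite !backB /u !mulrBr; have := low n; lra.
Qed.

Lemma alpha_le_gap m (sigma tau : 'S_m) (Z := 1 + (3 * m%:R)^-1) (q := m%:R / ((m + m.-1)`!)%:R)
    j n : (4 <= m)%N ->
    (forall d, (0 < d < m.-1)%N -> ~~ ov tau d) -> pcl2 tau m.-1 <= q -> (0 < j < m)%N ->
    q * Z ^+ (m.-1 - j) + \sum_(m - j <= s < m) Z ^+ s * pcl3 sigma s j <= pcl2 sigma j ->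
  (alpha n tau <= alpha n sigma)%N.
Proof.
move=> m4 nov tq jm cond; rewrite alpha_pav.
have Z1 : 1 <= Z by rewrite lerDl invr_ge0 mulr_ge0 ?ler0n.
have q0 : 0 <= q by rewrite divr_ge0 ?ler0n.
have c0 : 0 <= 1 / (m`!)%:R :> rat by rewrite divr_ge0 ?ler0n.
have KZ := pow_div_fact m4; rewrite -/Z in KZ.
have ratio k : pav sigma k <= Z * pav sigma k.+1.
  (* Used here with q = 0 for the growth bound of [sigma], and below with the actual q for the sign
     of the difference. *)
  have [] // := @recurrence_ge0 (pav sigma) m 1 (1 / (m`!)%:R) 0 Z _ _ Z1 c0 _ KZ _ _ k.
  - by lia.
  - exact: pr_ge0.
  by move=> i; rewrite mul0r addr0 pav_rec_weak //; lia.
have low := pav_rec_strong Z1 ratio jm q0 cond.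
have m1 : (1 < m)%N by lia.
have u0 : 0 <= pav sigma 0 - pav tau 0 by rewrite !pav_small ?subrr //; lia.
have [] := recurrence_ge0 (ltnW m1) _ Z1 c0 q0 KZ u0 (pav_diff_rec m1 nov tq low) n; first lia.
by rewrite subr_ge0.
Qed.

(* For m = 3 no geometric ratio bound propagates through the recurrence alone;
   eight consecutive instances of it combine to a positive one instead. *)
Lemma recurrence3_ge0 (u : nat -> rat) : u 0%N = 0 ->
    (forall n, u n - 1 / 6%:R * back u n.+1 3 + 1 / 40%:R * back u n.+1 5 <= u n.+1) ->
  forall n, 0 <= u n.
Proof.
move=> u0 rec.
(* Padding with zeros absorbs the truncation in [back], so that a single recurrence holds at all
   indices. *)
pose v n := if (n < 16)%N then 0 else u (n - 16)%N.
have h i : v i.+4 - v i.+2 / 6%:R + v i / 40%:R <= v i.+4.+1.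
  have [i11|i11] := leqP i 11.
    have v0 k : (k <= 16)%N -> v k = 0.
      by rewrite /v leq_eqVlt => /orP[/eqP->|->].
    by rewrite !v0; [lra|lia..].
  have [n iE] : exists n, i = (n + 12)%N by exists (i - 12)%N; lia.
  have v1 : v i.+4.+1 = u n.+1 by rewrite /v iE ifF; [congr u|]; lia.
  have v2 : v i.+4 = u n by rewrite /v iE ifF; [congr u|]; lia.
  have v3 : v i.+2 = back u n.+1 3.
    rewrite /v /back iE; case: ltnP => h1; case: ltnP => h2; try lia; first exact: erefl.
    by congr u; lia.
  have v4 : v i = back u n.+1 5.
    rewrite /v /back iE; case: ltnP => h1; case: ltnP => h2; try lia; first exact: erefl.
    by congr u; lia.
  by rewrite v1 v2 v3 v4; have := rec n; lra.
(* The instances at n, ..., n + 7 bound v(n+5), ..., v(n+12) below; a linear combination of them and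
   of the twelve earlier signs gives the claim. *)
have vS n : (forall k, (k < n + 12)%N -> 0 <= v k) -> 0 <= v (n + 12)%N.
  move=> p.
  have p_ k : (k < 12)%N -> 0 <= v (k + n)%N by move=> k12; apply: p; rewrite addnC ltn_add2l.
  have := (p_ 0%N isT, p_ 1%N isT, p_ 2 isT, p_ 3 isT, p_ 4 isT, p_ 5 isT, p_ 6 isT,
           p_ 7 isT, p_ 8 isT, p_ 9 isT, p_ 10 isT, p_ 11 isT).
  have := (h n, h n.+1, h n.+2, h n.+3, h n.+4, h n.+4.+1, h n.+4.+2, h n.+4.+3).
  rewrite (addnC n) !addSn !add0n.
  move=> [[[[[[[h0 h1] h2] h3] h4] h5] h6] h7].
  move=> [[[[[[[[[[[p0 p1] p2] p3] p4] p5] p6] p7] p8] p9] p10] p11].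
  lra.
have v_ge0 n : 0 <= v n.
  elim/ltn_ind: n => n IH; have [n12|n12] := ltnP n 12.
    by rewrite /v ifT //; lia.
  by rewrite -(subnK n12); apply: vS => k; rewrite subnK // => /IH.
by move=> n; have := v_ge0 (n + 16)%N; rewrite /v addnK ifF //; lia.
Qed.

(** The recurrence with shift 1 and the computed triple bound yields growth ratio 4/3 for [sigma];
    the value 1/40 is q = 3/5!. *)
Lemma alpha_le_3 (sigma tau : 'S_3) n : ov sigma 1 ->
    (forall d, (0 < d < 2)%N -> ~~ ov tau d) -> pcl2 tau 2 <= 3%:R / (5`!)%:R ->
  (alpha n tau <= alpha n sigma)%N.
Proof.
move=> ov1 nov tq; rewrite alpha_pav.
set p := pav sigma.
have p0 k : 0 <= p k by apply: pr_ge0.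
have mono k : p k.+1 <= p k by apply: pavS_le.
have c2 : 1 / 24%:R <= pcl2 sigma 1 by apply: (@pcl2_ov_ge 3 sigma 1 isT ov1).
have c3 : pcl3 sigma 2 1 <= 1 / 720%:R by have := pcl3_3 sigma; rewrite (_ : 6`! = 720)%N.
have c30 : 0 <= pcl3 sigma 2 1 by apply: pr_ge0.
have fact3 : (3`!)%:R = 6%:R :> rat by [].
have step k : p k.+3 - p k.+1 / 6%:R + p k / 24%:R - back p k 2 / 720%:R <= p k.+4.
  have := @pav_lower 3 sigma k 1 k.+3 isT; rewrite -/p => /(_ (esym (addn4 k))).
  rewrite big_nat1 fact3 addn1.
  have b0 := back_ge0 k 2 p0.
  have := ler_wpM2l (p0 k) c2; have := ler_wpM2l b0 c3; lra.
have ratio k : p k <= 4%:R / 3%:R * p k.+1.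
  elim/ltn_ind: k => k IH.
  have small i : (i < 3)%N -> p i = 1 by apply: pav_small.
  have [s0 s1 s2] : [/\ p 0%N = 1, p 1%N = 1 & p 2 = 1] by split; apply: small.
  case: k IH => [|[|[|k]]] IH.
  - by rewrite s0 s1; lra.
  - by rewrite s1 s2; lra.
  - have := @pav_rec_weak 3 sigma 2 isT.
    rewrite (_ : back _ 3 3 = p 0%N); last exact: erefl.
    rewrite fact3 -/p s0 s2; lra.
  have r0 := IH k (leqW (leqW (leqnn _))); have r1 := IH k.+1 (leqW (leqnn _)).
  have r2 := IH k.+2 (leqnn _).
  have b : back p k 2 <= (4%:R / 3%:R) ^+ 2 * p k.
    have z0 : 0 <= 4%:R / 3%:R :> rat by lra.
    rewrite /back; have [k2|k2] := leqP 2 k; last first.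
      by apply: mulr_ge0; [apply: exprn_ge0 | apply: p0].
    rewrite -[X in _ <= _ * p X](subnK k2); apply: ratio_iter => [|i ik]; first exact: z0.
    by apply: (IH i); rewrite subnK // in ik; do 3 apply: leqW.
  have := step k; have := mono k; have := p0 k.+3.
  move: b; rewrite expr2; lra.
have cond : 1 / 40%:R * (4%:R / 3%:R) ^+ (3.-1 - 1)
    + \sum_(3 - 1 <= s < 3) (4%:R / 3%:R) ^+ s * pcl3 sigma s 1 <= pcl2 sigma 1.
  have e1 : (3 - 1 = 2)%N := erefl.
  have e2 : (3.-1 - 1 = 1)%N := erefl.
  rewrite e2 e1 big_nat1 expr1 expr2; lra.
have z1 : 1 <= 4%:R / 3%:R :> rat by lra.
have z2 : 0 <= 1 / 40%:R :> rat by lra.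
have low := @pav_rec_strong 3 sigma (4%:R / 3%:R) (1 / 40%:R) 1 z1 ratio isT z2 cond.
have e5 : (5`!)%:R = 120%:R :> rat by [].
have tq' : pcl2 tau 3.-1 <= 1 / 40%:R by move: tq; rewrite e5; lra.
have := @pav_diff_rec 3 sigma tau _ isT nov tq' low; rewrite fact3 => rec.
have := @recurrence3_ge0 (fun k => pav sigma k - pav tau k) _ rec n.
rewrite subr_ge0; apply.
by rewrite !pav_small ?subrr.
Qed.

End Assembly.

(** * Binomial estimates and the cases by end entries *)

Lemma bin_ge n k : 0 < k < n -> n <= 'C(n, k).
Proof.
elim: n k => [|n IH] [|k] //= kn; rewrite binS.
have [e|lt] : k.+1 = n \/ k.+1 < n by lia.
  by rewrite -e binn binSn; lia.
have := IH k.+1 lt; have : 0 < 'C(n, k) by rewrite bin_gt0; lia.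
lia.
Qed.

Lemma bin2_ge q c : 2 <= q -> 2 <= c -> 2 * q.+1 <= 'C(q + c, q).
Proof.
move=> q2 c2; apply: (@leq_trans 'C(q + 2, q)); last by apply: leq_bin2l; rewrite leq_add2l.
rewrite -(bin_sub (leq_addr 2 q)) addKn.
have := mul_bin_left (q + 2) 1; rewrite bin1; nia.
Qed.

(** Each binomial is at least its upper index; these indices are at least 2 and add up to 2q, so
    their product is at least 4q - 4. *)
Lemma interior_bin_ge q a b : 3 <= q -> 0 < a < q -> 0 < b < q ->
  2 * q.+1 <= 'C(a + b, b) * 'C((q - a) + (q - b), q - b).
Proof.
move=> q3 aq bq.
have h1 : a + b <= 'C(a + b, b) by apply: bin_ge; lia.
have h2 : (q - a) + (q - b) <= 'C((q - a) + (q - b), q - b) by apply: bin_ge; lia.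
apply: leq_trans (leq_mul h1 h2); move: h1 h2 => _ _.
have [x xE] : exists x, a + b = x.+2 by exists (a + b - 2); lia.
have [z zE] : exists z, (q - a) + (q - b) = z.+2 by exists ((q - a) + (q - b) - 2); lia.
have xz : q + q = x + z + 4 by lia.
rewrite xE zE; move: aq bq xE zE => _ _ _ _.
have -> : x.+2 * z.+2 = x * z + 2 * x + 2 * z + 4 by rewrite !mulSn !mulnS; lia.
by lia.
Qed.

(** With q = m - 1 the bound is 2m. If an end entry is extreme, the other binomial factor alone is
    large enough. *)
Lemma cross_bin_ge q a b : 3 <= q -> a <= q -> b <= q ->
    (a = 0 -> b < q.-1) -> (b = 0 -> a < q.-1) -> (a = q -> 1 < b) -> (b = q -> 1 < a) ->
  2 * q.+1 <= 'C(a + b, b) * 'C((q - a) + (q - b), q - b).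
Proof.
move=> q3 aq bq a0b b0a aqb bqa.
have q2 : 2 <= q by apply: ltnW.
have sub2 c : c < q.-1 -> 2 <= q - c by move=> {aq bq a0b b0a aqb bqa}; lia.
have pos n k : k <= n -> 0 < 'C(n, k) by rewrite bin_gt0.
have sym x y : 'C(x + y, y) = 'C(y + x, y) by rewrite addnC.
have [a0|a0] := posnP a.
  rewrite a0 add0n binn mul1n subn0; rewrite -bin_sub ?leq_addl // addnK.
  exact: bin2_ge q2 (sub2 _ (a0b a0)).
have [b0|b0] := posnP b.
  rewrite b0 addn0 bin0 mul1n subn0 sym; exact: bin2_ge q2 (sub2 _ (b0a b0)).
have [aq'|aq'] := eqVneq a q.
  rewrite -bin_sub ?leq_addl // addnK -[X in X <= _]muln1 leq_mul ?pos ?leq_addl //.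
  by rewrite aq'; exact: bin2_ge q2 (aqb aq').
have [bq'|bq'] := eqVneq b q.
  rewrite -[X in X <= _]muln1 leq_mul ?pos ?leq_addl //.
  by rewrite sym bq'; exact: bin2_ge q2 (bqa bq').
by apply: interior_bin_ge; rewrite ?a0 ?b0 // ltn_neqAle ?aq' ?bq'.
Qed.

(** The four pairs are the ends of [tau], its reversal, its complement and its reversed complement,
    in this order. *)
Lemma alpha_le_same_ends m (sigma tau : 'S_m) n : 1 < m ->
    (forall d, 0 < d < m.-1 -> ~~ ov sigma d) -> (forall d, 0 < d < m.-1 -> ~~ ov tau d) ->
    (let c x := m.-1 - x in
     (wd sigma 0, wd sigma m.-1) \in
       [:: (wd tau 0, wd tau m.-1); (wd tau m.-1, wd tau 0);
           (c (wd tau 0), c (wd tau m.-1)); (c (wd tau m.-1), c (wd tau 0))]) ->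
  alpha n tau <= alpha n sigma.
Proof.
move=> m1 nos not.
have nor d : 0 < d < m.-1 -> ~~ ov (revp m * tau)%g d.
  by move=> dm; apply: contra (not d dm); apply: ov_rev.
have noc d : 0 < d < m.-1 -> ~~ ov (tau * revp m)%g d.
  by move=> dm; apply: contra (not d dm); apply: ov_comp.
have norc d : 0 < d < m.-1 -> ~~ ov (revp m * tau * revp m)%g d.
  by move=> dm; apply: contra (nor d dm); apply: ov_comp.
have m0 : 0 < m by lia.
have q0 : m.-1 < m by lia.
have tl i : i < m -> wd tau i < m by apply: wd_lt.
rewrite /= !inE !xpair_eqE => /or4P[] /andP[/eqP e0 /eqP e1].
- by rewrite (alpha_same_ends n m1 nos not).
- rewrite (alpha_same_ends n m1 nos nor) ?alpha_rev // wdM // wd_revp ?subn0 //.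
  by rewrite subnn.
- by rewrite (alpha_same_ends n m1 nos noc) ?alpha_comp // wdM // wd_revp ?tl.
rewrite (alpha_same_ends n m1 nos norc) ?(leq_trans (alpha_rev _ _) (alpha_comp _ _)) //.
  by rewrite !wdM // !wd_revp ?subn0 ?tl.
by rewrite !wdM // !wd_revp ?subnn ?tl.
Qed.

(** The first two and the last two entries both ascend or both descend, so the pattern overlaps
    itself in two entries. *)
Lemma extreme_ends_ov m (sigma : 'S_m) : 2 < m ->
    (wd sigma 0 = 0 /\ wd sigma m.-1 = m.-1) \/ (wd sigma 0 = m.-1 /\ wd sigma m.-1 = 0) ->
  ov sigma m.-2.
Proof.
move=> m3 ends.
have [m0 m1 q0 r0] : [/\ 0 < m, 1 < m, m.-1 < m & m.-2 < m] by split; lia.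
have [q2 r2] : 1 <> m.-1 /\ m.-2 <> 0 by lia.
have [rq rS] : m.-2 <> m.-1 /\ m.-2.+1 = m.-1 by lia.
have i1 : wd sigma 1 <> wd sigma 0 by move/(wd_inj m1 m0).
have i2 : wd sigma 1 <> wd sigma m.-1 by move/(wd_inj m1 q0).
have i3 : wd sigma m.-2 <> wd sigma m.-1 by move/(wd_inj r0 q0).
have i4 : wd sigma m.-2 <> wd sigma 0 by move/(wd_inj r0 m0).
have l1 := wd_lt sigma m1; have l2 := wd_lt sigma r0.
apply/ordlikeP => a b; rewrite (_ : m - m.-2 = 2); last lia.
case: a => [|[|]] // _; case: b => [|[|]] // _; rewrite /shift ?addn0 ?addn1 ?ltnn // rS.
  by case: ends => -[e0 e1]; move: i1 i2 i3 i4; rewrite e0 e1 => *; lia.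
by case: ends => -[e0 e1]; move: i1 i2 i3 i4; rewrite e0 e1 => *; lia.
Qed.

(** Provides the hypotheses of [cross_bin_ge]; for m = 3 the six listed pairs are all there are. *)
Lemma generic_ends m a b : 2 < m -> a < m -> b < m -> a <> b ->
    (a, b) \notin [:: (0, m.-2); (m.-2, 0); (m.-1, 1); (1, m.-1); (0, m.-1); (m.-1, 0)] ->
  [/\ 3 < m, a = 0 -> b < m.-2, b = 0 -> a < m.-2, a = m.-1 -> 1 < b & b = m.-1 -> 1 < a].
Proof.
move=> m3 am bm ab nsp.
have neq x y : (x, y) \in [:: (0, m.-2); (m.-2, 0); (m.-1, 1); (1, m.-1); (0, m.-1); (m.-1, 0)] ->
    a = x -> b <> y.
  by move=> h ax bY; case/negP: nsp; rewrite ax bY.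
have := (neq 0 m.-2, neq m.-2 0, neq m.-1 1, neq 1 m.-1, neq 0 m.-1, neq m.-1 0).
rewrite !inE !eqxx ?orbT /=.
case=> -[[[[h1 h2] h3] h4] h5] h6.
have {}h1 := h1 isT; have {}h2 := h2 isT; have {}h3 := h3 isT.
have {}h4 := h4 isT; have {}h5 := h5 isT; have {}h6 := h6 isT.
split.
- have [//|m3'] : 3 < m \/ m = 3 by move: h1 h2 h3 h4 h5 h6 nsp {neq} => *; lia.
  move: am bm ab nsp; rewrite m3'.
  by case: (a) => [|[|[|]]] //; case: (b) => [|[|[|]]].
- by move=> a0; move: (h1 a0) (h5 a0) bm => {h1 h2 h3 h4 h5 h6 neq nsp am ab} *; lia.
- move=> b0; have n2 : a <> m.-2 by move/h2.
  have n6 : a <> m.-1 by move/h6.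
  by move: n2 n6 am => {h1 h2 h3 h4 h5 h6 neq nsp bm ab} *; lia.
- by move=> a1; move: (h3 a1) (h6 a1) => {h1 h2 h3 h4 h5 h6 neq nsp am bm ab} *; lia.
move=> b1; have n4 : a <> 1 by move/h4.
have n5 : a <> 0 by move/h5.
by move: n4 n5 => {h1 h2 h3 h4 h5 h6 neq nsp bm ab am} *; lia.
Qed.

Section SwapLeast.
Variables (m : nat) (hm : 2 <= m) (sigma : 'S_m) (n : nat).
Let tau := swap_last_two hm.

Let tauE i : i < m -> wd tau i = if i == m - 2 then m - 1 else if i == m - 1 then m - 2 else i.
Proof. exact: wd_swap_last_two. Qed.

Lemma alpha_swap_le_2 : m = 2 -> alpha n tau <= alpha n sigma.
Proof.
move=> m2; have [m0 q0] : 0 < m /\ m.-1 < m by lia.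
have t0 : wd tau 0 = 1 by rewrite tauE // ifT ?m2.
have t1 : wd tau m.-1 = 0 by rewrite tauE // ifF ?ifT ?m2.
apply: alpha_le_same_ends => //; try by move=> d; lia.
have := wd_lt sigma m0; have := wd_lt sigma q0.
have : wd sigma 0 != wd sigma m.-1 by apply/eqP => /(wd_inj m0 q0); lia.
rewrite /= !inE !xpair_eqE t0 t1.
move: (wd sigma 0) (wd sigma m.-1) => a b; rewrite m2.
by case: a => [|[|]] //; case: b => [|[|]].
Qed.

Hypothesis m3 : 2 < m.

Let nov_tau d : 0 < d < m.-1 -> ~~ ov tau d.
Proof. exact: swap_nonoverlap. Qed.

Let tau_le : (pcl2 tau m.-1 <= m%:R / ((m + m.-1)`!)%:R)%R.
Proof. exact: swap_pcl2_le. Qed.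

Lemma alpha_swap_le_overlap d : 0 < d < m.-1 -> ov sigma d -> alpha n tau <= alpha n sigma.
Proof.
move=> dm ovd; have ex : exists j, (0 < j < m.-1) && ov sigma j by exists d; rewrite dm.
(* Take the smallest overlapping shift, so that triple clusters with a smaller first distance
   vanish. *)
case: (ex_minnP ex) => j /andP[jm ovj] jmin {d dm ovd ex}.
have {}jmin d : 0 < d < j -> ~~ ov sigma d.
  move=> /andP[d0 dj]; apply/negP => od; move: (dj); rewrite ltnNge => /negP; apply.
  by apply: jmin; rewrite od andbT d0; case/andP: jm => _; apply: ltn_trans.
have [m3'|m4] : m = 3 \/ 3 < m by lia.
  have j1 : j = 1 by lia.
  rewrite j1 in ovj; move: (sigma) ovj (nov_tau) (tau_le); rewrite /tau; move: (hm).
  by rewrite m3' => hm' s ov1 nov le; exact: alpha_le_3 n ov1 nov le.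
have jm1 : 0 < j < m by lia.
have [sp|gen] := boolP ((4 < m) || (j < 2)).
  exact: (alpha_le_gap n m4 nov_tau tau_le jm1 (gap_overlap m4 jm ovj jmin sp)).
have [m4' j2] : m = 4 /\ j = 2 by lia.
move: (sigma) ovj (nov_tau) (tau_le); rewrite /tau; move: (hm); rewrite m4' j2 => hm' s ov2 nov le.
exact: (@alpha_le_gap 4 s _ 2 n isT nov le isT (gap_4 ov2)).
Qed.

Lemma alpha_swap_le_nonoverlap :
  (forall d, 0 < d < m.-1 -> ~~ ov sigma d) -> alpha n tau <= alpha n sigma.
Proof.
move=> nov; have [m0 m1 q0] : [/\ 0 < m, 1 < m & m.-1 < m] by split; lia.
have tau0 : wd tau 0 = 0 by rewrite tauE // !ifF //; apply/eqP; lia.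
have tau1 : wd tau m.-1 = m.-2.
  by rewrite tauE // ifF ?ifT ?subn2 //; apply/eqP; lia.
have e1 : m.-1 - m.-2 = 1 by lia.
have [sp|nsp] := boolP ((wd sigma 0, wd sigma m.-1) \in
    [:: (0, m.-2); (m.-2, 0); (m.-1, 1); (1, m.-1)]).
  by apply: alpha_le_same_ends => //=; rewrite tau0 tau1 subn0 e1.
have noext : ~~ ov sigma m.-2 by apply: nov; lia.
have nsp' : (wd sigma 0, wd sigma m.-1) \notin
    [:: (0, m.-2); (m.-2, 0); (m.-1, 1); (1, m.-1); (0, m.-1); (m.-1, 0)].
  apply: contra noext; rewrite -[X in _ \in X](cat_take_drop 4) mem_cat (negPf nsp) /=.
  rewrite !inE !xpair_eqE => /orP[] /andP[/eqP a0 /eqP b0]; apply: extreme_ends_ov => //.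
    by left.
  by right.
have nab : wd sigma 0 <> wd sigma m.-1 by move/(wd_inj m0 q0); lia.
have [a_lt b_lt] := (wd_lt sigma m0, wd_lt sigma q0).
have [m4 a0 b0 a1 b1] := generic_ends m3 a_lt b_lt nab nsp'.
have jm : 0 < m.-1 < m by lia.
apply: (alpha_le_gap n m4 nov_tau tau_le jm (gap_cross m4 nov _)).
(* Twice q amounts to 2m clusters, which the crossing chains supply for these end entries. *)
rewrite mulrA -natrM; apply: pr_ge_cnt; apply: leq_trans (cross_cnt_ge sigma m1).
have := @cross_bin_ge m.-1 (wd sigma 0) (wd sigma m.-1).
by rewrite prednK //; apply => //; rewrite -ltnS prednK.
Qed.

End SwapLeast.

Lemma alpha_swap_le m (hm : 2 <= m) (sigma : 'S_m) n :
  alpha n (swap_last_two hm) <= alpha n sigma.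
Proof.
have [m2|m3] : m = 2 \/ 2 < m by lia.
  exact: alpha_swap_le_2.
have [/existsP[d /andP[dm ovd]]|/existsPn nov] :=
    boolP [exists d : 'I_m, (0 < d < m.-1) && ov sigma d].
  exact: alpha_swap_le_overlap ovd.
apply: alpha_swap_le_nonoverlap => // d dm; have dlt : d < m by lia.
by have := nov (Ordinal dlt); rewrite negb_and /= dm.
Qed.

Theorem theorem4p1 (m : nat) (hm : 2 <= m) (sigma : 'S_m) :
  exists n0 : nat, forall n : nat, n0 <= n ->
    alpha n (swap_last_two hm) <= alpha n sigma.
Proof. by exists 0 => n _; apply: alpha_swap_le. Qed.
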